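(* Let $c,n,k,\rho$, $I_c$ and $A_{n,\rho,j}^{(k)}$, $V_{n,\rho}^{(k)}$, $D_{n,\rho}^{(k)}$, $E_{n,\rho}^{(k)}$ be as in the context. Let $f\in C^2(I_c)$ with $\|f''\|_\infty=\sup_{t\in I_c}|f''(t)|<\infty$. Then, for every $j\in J$ and every $x\in I_c$, $$\left|A_{n,\rho,j}^{(k)}(f)-f\!\left(\frac{(2j+k)\rho+k}{2(n\rho-kc)}\right)\right|\le\frac12\|f''\|_\infty\operatorname{Var}A_{n,\rho,j}^{(k)},$$ $$\left|V_{n,\rho}^{(k)}f(x)-D_{n,\rho}^{(k)}f(x)\right|\le\frac12E_{n,\rho}^{(k)}(x)\,\|f''\|_\infty,$$ $$\left|V_{n,\rho}^{(k)}f(x)-f\!\left(\frac{2(n+kc)\rho x+k(\rho+1)}{2(n\rho-kc)}\right)\right|\le\frac12\|f''\|_\infty\operatorname{Var}_xV_{n,\rho}^{(k)} .$$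
   Context: Let $c,n\in\mathbb{R}$ with $n>c$ if $c\ge 0$ and $-n/c\in\mathbb{N}$ if $c<0$. Let $I_c=[0,\infty)$ if $c\ge0$ and $I_c=[0,-1/c]$ if $c<0$. Let $k,\rho\in\mathbb{N}=\{1,2,\dots\}$, with $k<-n/c$ if $c<0$, and assume $n\rho>(k+1)c$. Write $e_i(t)=t^i$. For $m>0$ (with $-m/c\in\mathbb{N}$ if $c<0$) and $l\in\mathbb{N}_0$ the basis functions (depending on $c$) are $$p_{m,l}(x)=\frac{m^l}{l!}x^le^{-mx}\ (c=0),\qquad p_{m,l}(x)=\frac{\prod_{i=0}^{l-1}(m+ci)}{l!}\,x^l(1+cx)^{-(m/c+l)}\ (c\ne0),$$ for $x\in I_c$; if $c<0$, only indices $0\le l\le -m/c$ are used ($p_{m,l}=0$ for larger $l$). The index set for $j$ is $J=\mathbb{N}_0$ if $c\ge 0$ and $J=\{0,1,\dots,-n/c-k\}$ if $c<0$. For $j\in J$ define the positive linear functional $$A_{n,\rho,j}^{(k)}(f)=\frac{n\rho-(k-1)c}{\rho^k}\sum_{i_1=0}^{\rho-1}\cdots\sum_{i_k=0}^{\rho-1}\int_{I_c}p_{n\rho-(k-2)c,\;j\rho+i_1+\dots+i_k+k-1}(t)\,f(t)\,dt,$$ which satisfies $A_{n,\rho,j}^{(k)}(e_0)=1$. Define $$V_{n,\rho}^{(k)}f=\sum_{j\in J}A_{n,\rho,j}^{(k)}(f)\,p_{n+kc,j}.$$ (This is the $k$-th order Kantorovich modification of the linking operators between Baskakov-type and genuine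 Baskakov–Durrmeyer type operators, normalized so that $V_{n,\rho}^{(k)}e_0=e_0$.) The associated discrete operator is $$D_{n,\rho}^{(k)}f=\sum_{j\in J}f\bigl(b_{n,\rho,j}^{(k)}\bigr)\,p_{n+kc,j},\qquad b_{n,\rho,j}^{(k)}:=A_{n,\rho,j}^{(k)}(e_1)=\frac{(2j+k)\rho+k}{2(n\rho-kc)} .$$ Further, $\operatorname{Var}A_{n,\rho,j}^{(k)}:=A_{n,\rho,j}^{(k)}(e_2)-\bigl(A_{n,\rho,j}^{(k)}(e_1)\bigr)^2$, $E_{n,\rho}^{(k)}(x):=\sum_{j\in J}\operatorname{Var}A_{n,\rho,j}^{(k)}\;p_{n+kc,j}(x)$, and $\operatorname{Var}_xV_{n,\rho}^{(k)}:=V_{n,\rho}^{(k)}e_2(x)-\bigl(V_{n,\rho}^{(k)}e_1(x)\bigr)^2$. *)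

(* Defs.v *)
From HB Require Import structures.
From mathcomp Require Export all_boot all_order all_algebra.
From mathcomp Require Export all_classical all_reals all_analysis.
Set Implicit Arguments.
Unset Strict Implicit.
Unset Printing Implicit Defensive.
Import Order.TTheory GRing.Theory Num.Theory.
Import numFieldNormedType.Exports.
Local Open Scope classical_set_scope.
Local Open Scope ring_scope.

Definition Ic (R : realType) (c : R) : set R :=
  if 0 <= c then `[0, +oo[%classic else `[0, - 1 / c]%classic.

(* For c < 0 and - m / c a natural number, the product contains the factor 0
   as soon as l > - m / c, hence pbasis c m l = 0 there.  At the right endpoint
   x = - 1 / c one has 1 + c * x = 0, and the library's 0 `^ 0 = 1 gives the
   polynomial value 1 + c * x raised to the natural number - m / c - l. *)
Definition pbasis (R : realType) (c m : R) (l : nat) (x : R) : R :=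
  if c == 0 then m ^+ l / (l`!)%:R * x ^+ l * expR (- (m * x))
  else (\prod_(i < l) (m + c * i%:R)) / (l`!)%:R * x ^+ l
         * (1 + c * x) `^ (- (m / c + l%:R)).

Definition inJ (R : realType) (c n : R) (k j : nat) : bool :=
  (0 <= c) || (j%:R <= - n / c - k%:R).

(* Only used for k >= 1, so k.-1 is the natural number k - 1; the iterated sum
   over i_1, ..., i_k is a sum over all functions i : 'I_k -> 'I_rho. *)
Definition Afun (R : realType) (c n : R) (k rho j : nat) (f : R -> R) : R :=
  (n * rho%:R - (k%:R - 1) * c) / rho%:R ^+ k *
  \sum_(i : {ffun 'I_k -> 'I_rho})
    \int[lebesgue_measure]_(t in Ic c)
      (pbasis c (n * rho%:R - (k%:R - 2) * c)
         (j * rho + \sum_(s < k) i s + k.-1)%N t * f t).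

(* For c < 0 only finitely many j satisfy inJ, so the partial sums are
   eventually constant and the limit is the finite sum. *)
Definition Vop (R : realType) (c n : R) (k rho : nat) (f : R -> R) (x : R) : R :=
  \big[+%R/0]_(0 <= j <oo | inJ c n k j)
    (Afun c n k rho j f * pbasis c (n + k%:R * c) j x).

Definition emon (R : realType) (i : nat) (t : R) : R := t ^+ i.

Definition bpt (R : realType) (c n : R) (k rho j : nat) : R :=
  Afun c n k rho j (@emon R 1).

Definition Dop (R : realType) (c n : R) (k rho : nat) (f : R -> R) (x : R) : R :=
  \big[+%R/0]_(0 <= j <oo | inJ c n k j)
    (f (bpt c n k rho j) * pbasis c (n + k%:R * c) j x).

Definition VarA (R : realType) (c n : R) (k rho j : nat) : R :=
  Afun c n k rho j (@emon R 2) - (Afun c n k rho j (@emon R 1)) ^+ 2.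

Definition Eop (R : realType) (c n : R) (k rho : nat) (x : R) : R :=
  \big[+%R/0]_(0 <= j <oo | inJ c n k j)
    (VarA c n k rho j * pbasis c (n + k%:R * c) j x).

Definition VarV (R : realType) (c n : R) (k rho : nat) (x : R) : R :=
  Vop c n k rho (@emon R 2) x - (Vop c n k rho (@emon R 1) x) ^+ 2.

(* Derivatives relative to I: one-sided at the endpoints of the interval I. *)
Definition slope (R : realType) (f : R -> R) (x y : R) : R :=
  (f y - f x) / (y - x).

Definition derivable_in (R : realType) (I : set R) (f : R -> R) (x : R) : Prop :=
  cvg (slope f x y @[y --> within I x^']).

Definition derive_in (R : realType) (I : set R) (f : R -> R) (x : R) : R :=
  lim (slope f x y @[y --> within I x^']).

Definition derive2_in (R : realType) (I : set R) (f : R -> R) : R -> R :=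
  derive_in I (derive_in I f).

Definition C2 (R : realType) (I : set R) (f : R -> R) : Prop :=
  [/\ forall x, I x -> derivable_in I f x,
      forall x, I x -> derivable_in I (derive_in I f) x &
      {within I, continuous (derive2_in I f)}].

Definition bounded_in (R : realType) (I : set R) (g : R -> R) : Prop :=
  has_ubound [set `|g t| | t in I].

Definition supnorm (R : realType) (I : set R) (g : R -> R) : R :=
  sup [set `|g t| | t in I].

(* Main.v *)
(** Integrating the derivative of a partial sum of the basis functions,
    [(\sum_(j <= l) p_(m, j))' = - m p_(m + c, l)], gives both the partition
    of unity (by the mean value theorem) and [\int p_(m, l) = 1 / (m - c)].
    Shifts of the parameter [m] absorb the factors [t] and [j], whence the
    moments of the functionals and of the operators.  All three estimates then
    come from the second-order Taylor bound of [f] around a point [a], to which a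
    normalized positive functional [A] is applied: [a = A e_1] turns
    [A (t - a)^2] into the variance of [A]. *)

Require Import Defs.
From mathcomp Require Import measurable_realfun ring lra zify.
Set Implicit Arguments.
Unset Strict Implicit.
Unset Printing Implicit Defensive.
Import Order.TTheory GRing.Theory Num.Theory.
Import numFieldNormedType.Exports.
Local Open Scope classical_set_scope.
Local Open Scope ring_scope.

(** Since only [f''] is bounded, [f] may grow quadratically, and for [0 <= c] neither its integrals
    nor its series converge for free. The Taylor bound serves twice: besides the estimates, it
    yields integrability and summability by comparison with second moments. Each factor [t] in an
    integral lowers the parameter by [c]; with [m = n * rho - (k - 2) * c] the second moment
    involves [m - 3 * c = n * rho - (k + 1) * c], whose positivity is the hypothesis [hnrho].
    Taylor's bound is available only around points of [Ic c], so the nodes [bpt] and the value of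
    [Vop] at [emon 1] must be shown to lie there. The third estimate expands around that last value
    and treats the whole operator as one functional; it is not deduced from the first two. The
    derivative formulas require [0 < 1 + c * x]. For [c < 0] this fails at the right endpoint, which
    therefore enters only through continuity and direct evaluation. *)

Definition weight (R : realType) (c m x : R) : R :=
  if c == 0 then expR (- (m * x)) else (1 + c * x) `^ (- (m / c)).

Definition rfact (R : realType) (c m : R) (l : nat) : R :=
  \prod_(i < l) (m + c * i%:R).

Definition psum (R : realType) (c m : R) (N : nat) (x : R) : R :=
  \sum_(j < N.+1) pbasis c m j x.

(** * Basis functions and their derivatives *)

Section Basis.
Variable R : realType.
Implicit Types (c m x : R) (l j N M : nat).

(** Merges the exponential case [c = 0] with the power case, so that most later identities need no
    split on [c]. *)
Lemma pbasisE c m l x :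
  pbasis c m l x = rfact c m l / l`!%:R * x ^+ l * weight c (m + c * l%:R) x.
Proof.
rewrite /pbasis /weight /rfact; case: ifPn => [/eqP ->|c0].
  rewrite mul0r addr0; congr (_ / _ * _ * _).
  by under eq_bigr do rewrite mul0r addr0; rewrite prodr_const card_ord.
by congr (_ * _ `^ _); field.
Qed.

Lemma weight0 c m : weight c m 0 = 1.
Proof. by rewrite /weight !mulr0 oppr0 expR0 addr0 powR1 if_same. Qed.

Lemma weight_ge0 c m x : 0 <= weight c m x.
Proof. by rewrite /weight; case: ifP => _; rewrite ?expR_ge0 ?powR_ge0. Qed.

(** The only differentiation in which the two cases are treated apart; the derivatives of all basis
    functions follow from it by the product rule. *)
Lemma is_derive_weight c m x : 0 < 1 + c * x ->
  is_derive x 1 (weight c m) (- m * weight c (m + c) x).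
Proof.
rewrite /weight; have [->|c0] := eqVneq c 0 => x0.
  by apply: is_derive_eq; rewrite addr0 /GRing.scale/=; ring.
have H : is_derive x 1 (fun y => 1 + c * y) c.
  by apply: is_derive_eq; rewrite /GRing.scale/=; ring.
have := @is_derive1_comp _ (fun y => y `^ (- (m / c))) (fun y => 1 + c * y) x _ _
  (is_derive1_powR (- (m / c)) x0) H.
move=> h; apply: (is_derive_eq h).
rewrite /GRing.scale /= (_ : - ((m + c) / c) = - (m / c) - 1); last by field.
by field.
Qed.

Lemma rfact0 c m : rfact c m 0 = 1.
Proof. by rewrite /rfact big_ord0. Qed.

Lemma rfactS c m l : rfact c m l.+1 = rfact c m l * (m + c * l%:R).
Proof. by rewrite /rfact big_ord_recr. Qed.

Lemma rfactSl c m l : rfact c m l.+1 = m * rfact c (m + c) l.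
Proof.
rewrite /rfact big_ord_recl mulr0 addr0; congr (_ * _).
by apply: eq_bigr => i _; rewrite lift0 -addn1 natrD; ring.
Qed.

Lemma factS_neq0 l : (l`!)%:R != 0 :> R.
Proof. by rewrite pnatr_eq0 -lt0n fact_gt0. Qed.

Lemma pbasis_x0 c m l : pbasis c m l 0 = (l == 0)%:R.
Proof.
rewrite pbasisE weight0; case: l => [|l]; first by rewrite rfact0 fact0 divr1 !mulr1.
by rewrite expr0n /= !(mulr0, mul0r).
Qed.

Lemma natS_neq0 l : l.+1%:R != 0 :> R. Proof. by rewrite pnatr_eq0. Qed.

Lemma is_derive_pbasis0 c m x : 0 < 1 + c * x ->
  is_derive x 1 (pbasis c m 0) (- m * pbasis c (m + c) 0 x).
Proof.
move=> /(is_derive_weight m).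
have -> : pbasis c m 0 = weight c m.
  by apply/funext => y; rewrite pbasisE rfact0 fact0 expr0 mulr0 addr0; field.
by rewrite pbasisE rfact0 fact0 expr0 mulr0 addr0 divr1 !mul1r.
Qed.

Lemma is_derive_pbasisS c m l x : 0 < 1 + c * x ->
  is_derive x 1 (pbasis c m l.+1)
    (m * pbasis c (m + c) l x - m * pbasis c (m + c) l.+1 x).
Proof.
move=> x0; have := is_derive_weight (m + c * l.+1%:R) x0.
set w := weight _ _ => dw.
have -> : pbasis c m l.+1 = (rfact c m l.+1 / (l.+1)`!%:R) \*: (id ^+ l.+1 * w).
  by apply/funext => y; rewrite pbasisE -mulrA /= !fctE.
apply: is_derive_eq; rewrite !fctE /GRing.scale /= !pbasisE.
rewrite (_ : m + c + c * l%:R = m + c * l.+1%:R); last by rewrite -(addn1 l) natrD; ring.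
rewrite (_ : m + c + c * l.+1%:R = m + c * l.+1%:R + c); last by ring.
have e : m * rfact c (m + c) l.+1 = m * rfact c (m + c) l * (m + c * l.+1%:R).
  by rewrite -!rfactSl rfactS.
rewrite !mulrA e -/w (rfactSl c m l) factS natrM exprS.
have := factS_neq0 l; have := natS_neq0 l.
set a := l.+1%:R; set b := _%:R; move=> a0 b0.
clearbody a b; by field; rewrite b0 a0.
Qed.

(** The derivatives of consecutive basis functions telescope, and only the last term survives. *)
Lemma is_derive_psum c m N x : 0 < 1 + c * x ->
  is_derive x 1 (psum c m N) (- m * pbasis c (m + c) N x).
Proof.
move=> x0; elim: N => [|N IH].
  have -> : psum c m 0 = pbasis c m 0.
    by apply/funext => y; rewrite /psum big_ord_recl big_ord0 addr0.
  exact: is_derive_pbasis0.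
have -> : psum c m N.+1 = psum c m N + pbasis c m N.+1.
  by apply/funext => y; rewrite /psum big_ord_recr.
have := is_derive_pbasisS m N x0 => H.
by apply: is_derive_eq; rewrite /=; ring.
Qed.

Lemma psum_x0 c m N : psum c m N 0 = 1.
Proof.
rewrite /psum big_ord_recl pbasis_x0 big1 ?addr0// => i _.
by rewrite pbasis_x0 lift0.
Qed.

(** The parameter [m + c * l] of [weight] does not change when [l] rises by one and [m] drops by
    [c]. This turns moments of integrals into plain integrals. *)
Lemma mulr_pbasis c m l x : m != c ->
  x * pbasis c m l x = (l%:R + 1) / (m - c) * pbasis c (m - c) l.+1 x.
Proof.
rewrite -subr_eq0 => mc; rewrite !pbasisE rfactSl subrK factS natrM exprS.
rewrite (_ : m - c + c * l.+1%:R = m + c * l%:R); last by rewrite -(addn1 l) natrD; ring.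
have := factS_neq0 l; have := natS_neq0 l; rewrite -(addn1 l) natrD.
by move=> a0 b0; field; rewrite b0 mc a0.
Qed.

(** The same invariance in the other direction, with the index falling and the parameter rising; it
    serves the sums over the index. *)
Lemma natr_mul_pbasis c m l x :
  l.+1%:R * pbasis c m l.+1 x = m * x * pbasis c (m + c) l x.
Proof.
rewrite !pbasisE rfactSl factS natrM exprS.
rewrite (_ : m + c + c * l%:R = m + c * l.+1%:R); last by rewrite -(addn1 l) natrD; ring.
have := factS_neq0 l; have := natS_neq0 l.
by set a := l.+1%:R; set b := l`!%:R => a0 b0; clearbody a b; field; rewrite b0 a0.
Qed.

Lemma rfact_ge0 c m l : (0 <= c -> 0 <= m) ->
  (c < 0 -> exists2 M : nat, m = - c * M%:R & (l <= M)%N) -> 0 <= rfact c m l.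
Proof.
move=> h1 h2; apply: prodr_ge0 => -[i il] _ /=.
case: (leP 0 c) => c0.
  by rewrite addr_ge0 ?h1// mulr_ge0.
have [M -> lM] := h2 c0; rewrite (_ : _ + _ = - c * (M%:R - i%:R)); last by ring.
rewrite mulr_ge0// ?oppr_ge0 ?(ltW c0)// subr_ge0 ler_nat.
by rewrite (leq_trans (ltnW il)).
Qed.

Lemma rfact_eq0 c m M l : m = - c * M%:R -> (M < l)%N -> rfact c m l = 0.
Proof.
move=> -> Ml; rewrite /rfact (bigD1 (Ordinal Ml))//=.
by rewrite (_ : _ + _ = 0) ?mul0r//; ring.
Qed.

Lemma pbasis_eq0 c m M l x : m = - c * M%:R -> (M < l)%N -> pbasis c m l x = 0.
Proof. by move=> h1 h2; rewrite pbasisE (rfact_eq0 h1 h2) !mul0r. Qed.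

Lemma pbasis_ge0 c m l x : (0 <= c -> 0 <= m) ->
  (c < 0 -> exists M : nat, m = - c * M%:R) -> 0 <= x -> 0 <= pbasis c m l x.
Proof.
move=> h1 h2 x0; rewrite pbasisE.
suff h : 0 <= rfact c m l by rewrite !mulr_ge0 ?weight_ge0 ?exprn_ge0.
case: (ltP c 0) => [c0|c0].
  have [M e] := h2 c0; case: (leqP l M) => lM; last by rewrite (rfact_eq0 e lM).
  by apply: rfact_ge0 => // _; exists M.
by apply: rfact_ge0 => // c0'; have := lt_le_trans c0' c0; rewrite ltxx.
Qed.

Lemma Ic_ge0 c x : Ic c x -> 0 <= x.
Proof. by rewrite /Ic; case: ifP => _ /=; rewrite in_itv/= => /andP[]. Qed.

Lemma Ic_1Dcx c x : Ic c x -> 0 <= 1 + c * x.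
Proof.
rewrite /Ic; case: (leP 0 c) => c0 /=; rewrite in_itv/= => /andP[x0 h].
  by rewrite addr_ge0// mulr_ge0.
have := ler_wpM2r (_ : 0 <= - c) h; rewrite oppr_ge0 (ltW c0) => /(_ isT).
rewrite (_ : - 1 / c * - c = 1); last by field; rewrite lt_eqF.
lra.
Qed.

Lemma IcP c x : Ic c x <-> 0 <= x /\ 0 <= 1 + c * x.
Proof.
split; first by move=> h; split; [exact: Ic_ge0 h|exact: Ic_1Dcx h].
move=> [x0 x1]; rewrite /Ic; case: (leP 0 c) => c0 /=; rewrite in_itv/= x0//=.
by rewrite ler_ndivlMr//; lra.
Qed.

Lemma continuous_pbasis c m l :
  (c < 0 -> exists2 M : nat, m = - c * M%:R & (l <= M)%N) ->
  {within Ic c, continuous (pbasis c m l)}.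
Proof.
case: (leP 0 c) => [c0 _|c0 /(_ isT)[M mM lM]].
  rewrite (_ : Ic c = `[0, +oo[%classic); last by rewrite /Ic c0.
  apply: derivable_within_continuous => x; rewrite in_itv/= andbT => x0.
  have x1 : 0 < 1 + c * x by rewrite ltr_pwDl// mulr_ge0.
  by case: l => [|l]; [have [] := is_derive_pbasis0 m x1|have [] := is_derive_pbasisS m l x1].
(* On [Ic c] the base [1 + c * x] is nonnegative and the exponent is the natural number [M - l], so
   the basis function agrees with a polynomial, even at the endpoint where the base is 0. *)
pose q := fun x : R => rfact c m l / l`!%:R * x ^+ l * (1 + c * x) ^+ (M - l).
have cq : continuous q.
  move=> x; apply: cvgM; first by apply: cvgM; [exact: cvg_cst|exact: exprn_continuous].
  apply: (continuous_comp (f := fun x => 1 + c * x) (g := fun y => y ^+ (M - l)));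
    last exact: exprn_continuous.
  by apply: cvgD; [exact: cvg_cst|apply: cvgM; [exact: cvg_cst|exact: cvg_id]].
apply: (@subspace_eq_continuous _ _ _ q _ _ (continuous_subspaceT cq)).
move=> x /set_mem/Ic_1Dcx x1; rewrite /from_subspace pbasisE /weight (lt_eqF c0).
congr (_ * _); rewrite -powR_mulrn// natrB// mM; congr (_ `^ _).
by field; rewrite lt_eqF.
Qed.

End Basis.

(** Parameters for which the basis is nonnegative on [Ic c]. The value 0 is included because for
    [c < 0] the shift from [m] to [m + c] can reach it. *)
Definition admissible (R : realType) (c m : R) : Prop :=
  (0 <= c -> 0 <= m) /\ (c < 0 -> exists M : nat, m = - c * M%:R).

(** * Partition of unity and discrete moments *)

Section Moments.
Variable R : realType.
Implicit Types (c m x y : R) (l j N M : nat).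

Lemma admissibleD c m : admissible c m -> m != 0 -> admissible c (m + c).
Proof.
move=> [h1 h2] m0; split=> [c0|c0]; first by rewrite addr_ge0// h1.
have [[|M] e] := h2 c0; first by move: m0; rewrite e mulr0 eqxx.
by exists M; rewrite e -addn1 natrD; ring.
Qed.

Lemma admissible_ge0 c m : admissible c m -> 0 <= m.
Proof.
move=> [h1 h2]; case: (leP 0 c) => [|c0]; first exact: h1.
by have [M ->] := h2 c0; rewrite mulr_ge0// oppr_ge0 ltW.
Qed.

Lemma admissible_pbasis_ge0 c m l x : admissible c m -> 0 <= x -> 0 <= pbasis c m l x.
Proof. by move=> [? ?]; exact: pbasis_ge0. Qed.

Lemma admissible_continuous_pbasis c m l : admissible c m ->
  {within Ic c, continuous (pbasis c m l)}.
Proof.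
move=> [_ h]; case: (ltP c 0) => c0; last first.
  by apply: continuous_pbasis => /(le_lt_trans c0); rewrite ltxx.
have [M e] := h c0; case: (leqP l M) => lM.
  by apply: continuous_pbasis => _; exists M.
have -> : pbasis c m l = cst 0 by apply/funext => x; exact: pbasis_eq0 e lM.
by apply: continuous_subspaceT => x; exact: cvg_cst.
Qed.

Lemma continuous_psum c m N : admissible c m ->
  {within Ic c, continuous (psum c m N)}.
Proof.
move=> am; elim: N => [|N IH].
  rewrite (_ : psum c m 0 = pbasis c m 0); first exact: admissible_continuous_pbasis.
  by apply/funext => y; rewrite /psum big_ord_recl big_ord0 addr0.
rewrite (_ : psum c m N.+1 = psum c m N \+ pbasis c m N.+1); last first.
  by apply/funext => y; rewrite /psum big_ord_recr.
by apply: within_continuousD; [exact: IH|exact: admissible_continuous_pbasis].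
Qed.

Lemma Ic_le c x y : Ic c x -> 0 <= y <= x -> Ic c y.
Proof.
move=> /IcP[x0 x1] /andP[y0 yx]; apply/IcP; split=> //.
case: (leP 0 c) => c0; first by rewrite addr_ge0// mulr_ge0.
by apply: (le_trans x1); rewrite lerD2l ler_wnM2l// ltW.
Qed.

Lemma Ic_lt c x y : Ic c x -> 0 <= y < x -> 0 < 1 + c * y.
Proof.
move=> /IcP[x0 x1] /andP[y0 yx]; case: (leP 0 c) => c0.
  by rewrite ltr_pwDl// mulr_ge0.
by apply: (le_lt_trans x1); rewrite ltrD2l ltr_nM2l.
Qed.

(** Mean value theorem on [[0, x]], where [psum] equals 1 at 0. Inside the interval [1 + c * y] is
    positive even if [x] is the right endpoint [- 1 / c]. *)
Lemma psumE c m N x : admissible c m -> Ic c x -> 0 < x ->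
  exists2 y, 0 < y < x & psum c m N x = 1 - m * x * pbasis c (m + c) N y.
Proof.
move=> am Ix x0.
have hd y : y \in `]0, x[%R ->
    is_derive y 1 (psum c m N) (- m * pbasis c (m + c) N y).
  rewrite in_itv/= => /andP[y0 yx]; apply: is_derive_psum.
  by apply: Ic_lt Ix _; rewrite (ltW y0).
have hc : {within `[0, x], continuous (psum c m N)}.
  apply: continuous_subspaceW (continuous_psum am) => y /=; rewrite in_itv/=.
  exact: Ic_le.
have [y] := MVT x0 hd hc; rewrite in_itv/= => xy e; exists y => //.
by move: e; rewrite psum_x0 subr0 => /eqP; rewrite subr_eq => /eqP ->; ring.
Qed.

Lemma psum_le1 c m N x : admissible c m -> Ic c x -> psum c m N x <= 1.
Proof.
move=> am Ix; have x0 := Ic_ge0 Ix.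
move: x0; rewrite le_eqVlt => /predU1P[<-|x0]; first by rewrite psum_x0.
have [y /andP[y0 _] ->] := psumE N am Ix x0.
rewrite gerBl; have [->|m0] := eqVneq m 0; first by rewrite !mul0r.
rewrite !mulr_ge0 ?(admissible_ge0 am) ?(ltW x0)//.
by apply: admissible_pbasis_ge0; [exact: admissibleD|exact: ltW].
Qed.

Lemma series_pbasisE c m N x : series (pbasis c m ^~ x) N.+1 = psum c m N x.
Proof. by rewrite /series /= big_mkord. Qed.

(** Nonnegative terms with partial sums at most 1 form a convergent series, so the terms tend to
    0. *)
Lemma pbasis_cvg0 c m x : admissible c m -> Ic c x ->
  pbasis c m N x @[N --> \oo] --> 0.
Proof.
move=> am Ix; apply: (@cvg_series_cvg_0 _ _ (pbasis c m ^~ x)).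
apply: nondecreasing_is_cvgn.
  apply: nondecreasing_series => l _ _.
  exact: admissible_pbasis_ge0 am (Ic_ge0 Ix).
exists 1 => _ [[|N] _ <-]; first by rewrite /series /= big_geq.
by rewrite series_pbasisE psum_le1.
Qed.

Lemma weightDn c m l x : 0 < 1 + c * x ->
  weight c (m + c * l%:R) x = weight c m x / (1 + c * x) ^+ l.
Proof.
move=> x0; rewrite /weight; case: eqP => [->|/eqP c0].
  by rewrite !mul0r !addr0 expr1n divr1.
rewrite (_ : - _ = - (m / c) - l%:R); last by field.
by rewrite powRB ?powR_mulrn ?(ltW x0)// (gt_eqF x0) implybT.
Qed.

Lemma weight_gt0 c m x : 0 < 1 + c * x -> 0 < weight c m x.
Proof. by rewrite /weight; case: ifP => _ h; rewrite ?expR_gt0 ?powR_gt0. Qed.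

Lemma weight_le1 c m x : 0 <= c -> 0 <= m -> 0 <= x -> weight c m x <= 1.
Proof.
move=> c0 m0 x0; rewrite /weight; case: eqP => [_|/eqP cn].
  by rewrite -expR0 ler_expR oppr_le0 mulr_ge0.
rewrite -[leRHS](powRr0 (1 + c * x)) ler_powR ?lerDl ?mulr_ge0//.
by rewrite oppr_le0 divr_ge0.
Qed.

(* [y / (1 + c * y)] increases with [y], so the terms of the series at [y] are
   controlled by those at a fixed larger point. *)
Lemma pbasis_le c m l x y : 0 <= c -> 0 <= m -> 0 <= y <= x ->
  pbasis c m l y <= pbasis c m l x / weight c m x.
Proof.
move=> c0 m0 /andP[y0 yx]; have x0 := le_trans y0 yx.
have h z : 0 <= z -> 0 < 1 + c * z by move=> z0; rewrite ltr_pwDl// mulr_ge0.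
have e z : 0 <= z -> pbasis c m l z =
    rfact c m l / l`!%:R * (z / (1 + c * z)) ^+ l * weight c m z.
  move=> z0; rewrite pbasisE weightDn ?h// expr_div_n; field.
  by rewrite expf_neq0 ?gt_eqF ?h ?ltr0n ?fact_gt0.
rewrite !e// mulfK ?gt_eqF ?weight_gt0 ?h//.
have r0 : 0 <= rfact c m l / l`!%:R.
  rewrite divr_ge0// rfact_ge0// => c0'.
  by have := lt_le_trans c0' c0; rewrite ltxx.
rewrite -[leRHS]mulr1 ler_pM ?weight_ge0 ?weight_le1//.
  by rewrite mulr_ge0// exprn_ge0// divr_ge0// ltW// h.
apply: ler_wpM2l => //; apply: lerXn2r; rewrite ?nnegrE ?divr_ge0 ?(ltW (h _ _))//.
by rewrite ler_pdivrMr ?h// mulrAC ler_pdivlMr ?h//; nra.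
Qed.

Lemma cvgn_eqS (u v : nat -> R) (l : R) :
  (forall n, u n.+1 = v n) -> v @ \oo --> l -> u @ \oo --> l.
Proof.
by move=> uv vl; rewrite -cvg_shiftS (_ : mk_sequence _ = v)//; apply/funext.
Qed.

(** The remainder in [psumE] is a basis function at a point [y] that depends on [N], so
    [pbasis_cvg0] does not apply to it directly. For [0 <= c], [pbasis_le] moves it to the fixed
    point [x]; for [c < 0] it vanishes as soon as [N] exceeds the degree. *)
Lemma cvg_series_pbasis c m x : admissible c m -> Ic c x ->
  series (pbasis c m ^~ x) @ \oo --> (1 : R).
Proof.
move=> am Ix; apply: (cvgn_eqS (v := psum c m ^~ x)) => [N|]; first exact: series_pbasisE.
have := Ic_ge0 Ix; rewrite le_eqVlt => /predU1P[<-|x0].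
  rewrite (_ : psum _ _ ^~ 0 = cst 1); first exact: cvg_cst.
  by apply/funext => N; rewrite psum_x0.
have [mn0|m0] := eqVneq m 0.
  apply: (@cvg_trans _ (cst 1 @ \oo)); last exact: cvg_cst.
  apply: near_eq_cvg; apply: nearW => N /=; have [y _ ->] := psumE N am Ix x0.
  by rewrite mn0; ring.
have am' := admissibleD am m0.
case: (leP 0 c) => c0.
  have mge0 := admissible_ge0 am.
  have x1 : 0 < 1 + c * x by rewrite ltr_pwDl// mulr_ge0// ltW.
  apply: (@squeeze_cvgr _ _ _ _
    (fun N => 1 - m * x / weight c (m + c) x * pbasis c (m + c) N x) (cst 1)).
  - near=> N; rewrite psum_le1// andbT.
    have [y /andP[y0 yx] ->] := psumE N am Ix x0.
    rewrite lerD2l lerN2 -[leRHS]mulrA [X in _ <= _ * X]mulrC ler_wpM2l//.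
      by rewrite mulr_ge0// ltW.
    by apply: pbasis_le => //; [rewrite addr_ge0|rewrite !ltW].
  - rewrite -[X in _ --> X]subr0 -[X in _ - X](mulr0 (m * x / weight c (m + c) x)).
    by apply: cvgB; [exact: cvg_cst|apply: cvgM; [exact: cvg_cst|exact: pbasis_cvg0]].
  - exact: cvg_cst.
have [M e] := am'.2 c0.
apply: (@cvg_trans _ (cst 1 @ \oo)); last exact: cvg_cst.
apply: near_eq_cvg; exists M.+1 => // N /= MN; have [y _ ->] := psumE N am Ix x0.
by rewrite (pbasis_eq0 _ e) //; ring.
Unshelve. all: by end_near. Qed.

(** The free factor [g] lets the shift be iterated: [g = 1] gives first moments and [g j = j] gives
    second moments. *)
Lemma series_natr_pbasisS c m N x (g : nat -> R) :
  series (fun j => g j * (j%:R * pbasis c m j x)) N.+1 =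
  m * x * series (fun j => g j.+1 * pbasis c (m + c) j x) N.
Proof.
rewrite /series /= big_nat_recl// mul0r mulr0 add0r mulr_sumr.
by apply: eq_bigr => i _; rewrite natr_mul_pbasis; ring.
Qed.

Lemma cvg_series_natr_pbasis c m x : admissible c m -> Ic c x ->
  series (fun j => j%:R * pbasis c m j x) @ \oo --> m * x.
Proof.
move=> am Ix; have e N : series (fun j => j%:R * pbasis c m j x) N.+1 =
    m * x * series (pbasis c (m + c) ^~ x) N.
  have := series_natr_pbasisS c m N x (fun=> 1).
  by under eq_fun do rewrite mul1r; under [in RHS]eq_fun do rewrite mul1r.
apply: (cvgn_eqS e); have [->|m0] := eqVneq m 0.
  rewrite (_ : (fun _ => _) = cst 0) ?mul0r; first exact: cvg_cst.
  by apply/funext => N; rewrite !mul0r.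
rewrite -[X in _ --> X]mulr1; apply: cvgM; first exact: cvg_cst.
by apply: cvg_series_pbasis => //; exact: admissibleD.
Qed.

Lemma is_cvg_series_sqr_pbasis c m x : admissible c m -> Ic c x ->
  cvgn (series (fun j => j.+1%:R ^+ 2 * pbasis c m j x)).
Proof.
move=> am Ix.
have h2 : series (fun j => j%:R * (j%:R * pbasis c m j x)) @ \oo -->
    m * x * ((m + c) * x + 1).
  apply: (cvgn_eqS (fun N => series_natr_pbasisS c m N x (fun j => j%:R))).
  have [->|m0] := eqVneq m 0.
    rewrite (_ : (fun _ => _) = cst 0) ?mul0r; first exact: cvg_cst.
    by apply/funext => N; rewrite !mul0r.
  have am' := admissibleD am m0; apply: cvgM; first exact: cvg_cst.
  have -> : (fun j => j.+1%:R * pbasis c (m + c) j x) =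
    (fun j => j%:R * pbasis c (m + c) j x) + pbasis c (m + c) ^~ x.
    by apply/funext => j /=; rewrite -addn1 natrD !fctE; ring.
  rewrite seriesD; apply: cvgD; first exact: cvg_series_natr_pbasis.
  exact: cvg_series_pbasis.
have -> : (fun j => j.+1%:R ^+ 2 * pbasis c m j x) =
   (fun j => j%:R * (j%:R * pbasis c m j x)) +
    2 *: (fun j => j%:R * pbasis c m j x) + pbasis c m ^~ x.
  by apply/funext => j /=; rewrite -addn1 natrD !fctE /GRing.scale/=; ring.
rewrite !seriesD; apply: is_cvgD; last exact: cvgP (cvg_series_pbasis am Ix).
apply: is_cvgD; first exact: cvgP h2.
exact: is_cvg_seriesZ (cvgP _ (cvg_series_natr_pbasis am Ix)).
Qed.

(** Comparison with the second moment. The growth of [g] is demanded only where the basis function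
    is nonzero, since for [c < 0] the coefficients are controlled only on the finite index set. *)
Lemma is_cvg_series_pbasis c m x (g : nat -> R) C : admissible c m -> Ic c x ->
  (forall j, pbasis c m j x != 0 -> `|g j| <= C * j.+1%:R ^+ 2) ->
  cvgn (series (fun j => g j * pbasis c m j x)).
Proof.
move=> am Ix hg; apply: normed_cvg.
apply: (@series_le_cvg _ _ (fun j => C * (j.+1%:R ^+ 2 * pbasis c m j x))) => [j|j|j|].
- exact: normr_ge0.
- have [->|p0] := eqVneq (pbasis c m j x) 0; first by rewrite !mulr0.
  have := hg j p0 => /(le_trans (normr_ge0 _)) h.
  rewrite mulrA mulr_ge0//; exact: admissible_pbasis_ge0 (Ic_ge0 Ix).
- rewrite /=; have [->|p0] := eqVneq (pbasis c m j x) 0.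
    by rewrite !mulr0 normr0.
  have p1 := admissible_pbasis_ge0 j am (Ic_ge0 Ix).
  by rewrite normrM (ger0_norm p1) mulrA ler_wpM2r// hg.
exact: (@is_cvg_seriesZ _ _ C (is_cvg_series_sqr_pbasis am Ix)).
Qed.

End Moments.

(** * Integrals of the basis functions *)

Section WeightedIntegral.
Context d (T : measurableType d) (R : realType).
Variable mu : {measure set T -> \bar R}.
Implicit Types (D : set T) (e p f g : T -> R) (u v K a : R).

Lemma integrable_scale D f K : measurable D -> mu.-integrable D (EFin \o f) ->
  mu.-integrable D (EFin \o (fun t => K * f t)).
Proof. move=> mD i; have := integrableZl mD K i.
by congr (integrable _ _ _); apply/funext => t /=; rewrite EFinM. Qed.

Lemma integrable_add D f g : measurable D -> mu.-integrable D (EFin \o f) ->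
  mu.-integrable D (EFin \o g) -> mu.-integrable D (EFin \o (fun t => f t + g t)).
Proof. move=> mD i j; have := integrableD mD i j.
by congr (integrable _ _ _); apply/funext => t /=; rewrite EFinD. Qed.

Lemma weighted_integral_bound D e p f u v K a : measurable D ->
  (forall t, D t -> 0 <= p t) ->
  mu.-integrable D (EFin \o p) ->
  mu.-integrable D (EFin \o (fun t => e t * p t)) ->
  mu.-integrable D (EFin \o (fun t => e t * (e t * p t))) ->
  measurable_fun D e -> measurable_fun D f ->
  (forall t, D t -> `|f t - (u + v * e t)| <= K * (e t - a) ^+ 2) ->
  `| \int[mu]_(t in D) (p t * f t)
     - (u * \int[mu]_(t in D) p t + v * \int[mu]_(t in D) (e t * p t)) |
  <= K * (\int[mu]_(t in D) (e t * (e t * p t)) - 2 * a * \int[mu]_(t in D) (e t * p t)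
          + a ^+ 2 * \int[mu]_(t in D) p t).
Proof.
move=> mD p0 i0 i1 i2 me mf hf.
set h := fun t => p t * (f t - (u + v * e t)).
set G := fun t => K * (e t * (e t * p t)) + ((- 2 * a * K) * (e t * p t) + (K * a ^+ 2) * p t).
set L := fun t => u * p t + v * (e t * p t).
have mp : measurable_fun D p by move/measurable_int : i0 => /measurable_EFinP.
have iG : mu.-integrable D (EFin \o G).
  by repeat (apply: integrable_add => //); apply: integrable_scale.
have iL : mu.-integrable D (EFin \o L).
  by apply: integrable_add => //; apply: integrable_scale.
have hG t : D t -> `|h t| <= G t.
  move=> Dt; rewrite /h normrM ger0_norm ?p0//.
  have := ler_wpM2l (p0 t Dt) (hf t Dt); rewrite /G.
  by move/le_trans; apply; rewrite le_eqVlt; apply/orP; left; apply/eqP; ring.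
(* Integrability of [p * f] is not assumed: [h] is dominated by the integrable [G], and [p * f] is
   [h] plus the integrable [L]. *)
have ih : mu.-integrable D (EFin \o h).
  apply: (le_integrable mD _ _ iG) => [|t Dt].
    apply/measurable_EFinP; apply: measurable_funM => //; apply: measurable_funB => //.
    apply: measurable_funD; first exact: measurable_cst.
    by apply: measurable_funM; [exact: measurable_cst|exact: me].
  by rewrite /= lee_fin (le_trans (hG t Dt))// ler_norm.
have e1 : \int[mu]_(t in D) (p t * f t) =
    \int[mu]_(t in D) h t + \int[mu]_(t in D) L t.
  by rewrite -RintegralD//; apply: eq_Rintegral => t _; rewrite /h /L; ring.
have e2 : \int[mu]_(t in D) L t =
    u * \int[mu]_(t in D) p t + v * \int[mu]_(t in D) (e t * p t).
  by rewrite RintegralD ?RintegralZl//; apply: integrable_scale.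
have e3 : \int[mu]_(t in D) G t = K * (\int[mu]_(t in D) (e t * (e t * p t))
    - 2 * a * \int[mu]_(t in D) (e t * p t) + a ^+ 2 * \int[mu]_(t in D) p t).
  rewrite RintegralD ?RintegralD ?RintegralZl//; last first.
  all: repeat (apply: integrable_add => //); try (apply: integrable_scale => //).
  by ring.
rewrite e1 e2 addrK -e3; apply: (le_trans (le_normr_Rintegral mD ih)).
apply: le_Rintegral => //.
apply: (le_integrable mD _ _ iG) => [|t Dt].
  apply/measurable_EFinP; apply: measurableT_comp => //.
  by move/measurable_int : ih => /measurable_EFinP.
by rewrite /= lee_fin normr_id (le_trans (hG t Dt))// ler_norm.
Qed.

End WeightedIntegral.

(** The range in which the integral is [1 / (m - c)]: for [0 <= c] the bound on [m] gives decay at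
    infinity, while for [c < 0] an index above [M] would make the basis function, hence its
    integral, zero. *)
Definition integrable_basis (R : realType) (c m : R) (l : nat) : Prop :=
  (0 <= c -> c < m) /\
  (c < 0 -> exists2 M : nat, m = - c * M%:R & (l <= M)%N).

Section BasisIntegral.
Variable R : realType.
Let mu := @lebesgue_measure R.
Implicit Types (c m x : R) (l M : nat).

Lemma measurable_Ic c : measurable (Ic c).
Proof. by rewrite /Ic; case: ifP => _; exact: measurable_itv. Qed.

Lemma cvg_pinfty_pbasis c m l : 0 <= c -> 0 < m ->
  pbasis c m l x @[x --> +oo] --> 0.
Proof.
rewrite le_eqVlt => /predU1P[<-|c0] m0.
  have am : admissible 0 m by split => [_|]; [exact: ltW|rewrite ltxx].
  have Ix x : 0 <= x -> Ic 0 x by move=> ?; apply/IcP; rewrite mul0r addr0.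
  have g0 : l.+1%:R / m * x^-1 @[x --> +oo] --> (0:R).
    rewrite -(mulr0 (l.+1%:R / m)).
    apply: cvgM; first exact: cvg_cst.
    by apply/(@gtr0_cvgV0 _ _ _ _ id); [exact: nbhs_pinfty_gt|exact: cvg_id].
  (* For [c = 0], [m * x * pbasis 0 m l x] equals [l.+1%:R * pbasis 0 m l.+1 x], which is at most
     [l.+1%:R] because a single term is bounded by [psum]. *)
  apply: (@squeeze_cvgr _ _ _ _ (cst 0) (fun x => l.+1%:R / m * x^-1));
    [|exact: cvg_cst|exact: g0].
  near=> x; have x0 : 0 < x by near: x; exact: nbhs_pinfty_gt.
  rewrite /= admissible_pbasis_ge0 ?(ltW x0)//=.
  rewrite -[leRHS]mulrA -invfM ler_pdivlMr ?mulr_gt0// [leLHS]mulrC.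
  rewrite -{2}(addr0 m) -natr_mul_pbasis.
  rewrite -[leRHS]mulr1 ler_wpM2l//.
  apply: le_trans (psum_le1 l.+1 am (Ix _ (ltW x0))).
  rewrite /psum big_ord_recr/= lerDr sumr_ge0// => i _.
  by rewrite admissible_pbasis_ge0// ltW.
have r0 : 0 < m / c by rewrite divr_gt0.
have hV : (1 + c * x)^-1 @[x --> +oo] --> 0^'+.
  move=> A [e e0 hA]; exists (c * e)^-1; split; first exact: num_real.
  move=> x xe; have ce : 0 < c * e by rewrite mulr_gt0.
  have x0 : 0 < x by rewrite (lt_trans _ xe)// invr_gt0.
  have x1 : 0 < 1 + c * x by rewrite ltr_pwDl// mulr_ge0// ltW.
  apply: hA; last by rewrite /= invr_gt0.
  rewrite /ball_ /= sub0r normrN gtr0_norm ?invr_gt0// -(invrK e).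
  rewrite ltf_pV2 ?posrE ?invr_gt0//.
  have h : c * (c * e)^-1 = e^-1 by field; rewrite !gt_eqF.
  by rewrite -h (lt_trans (_ : _ < c * x)) ?ltr_pM2l// ltrDr.
(* From [c * x <= 1 + c * x], the quotient [x ^+ l / (1 + c * x) ^+ l] is at most [1 / c ^+ l]; the
   remaining power [- (m / c)] supplies the decay. *)
set C := rfact c m l / l`!%:R / c ^+ l.
have g0 : C * (1 + c * x)^-1 `^ (m / c) @[x --> +oo] --> (0:R).
  rewrite -(mulr0 C); apply: cvgM; first exact: cvg_cst.
  exact: cvg_comp hV (powR_cvg0 r0).
apply: (@squeeze_cvgr _ _ _ _ (cst 0) (fun x => C * (1 + c * x)^-1 `^ (m / c)));
  [|exact: cvg_cst|exact: g0].
near=> x; have x0 : 0 < x by near: x; exact: nbhs_pinfty_gt.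
have x1 : 0 < 1 + c * x by rewrite ltr_pwDl// mulr_ge0// ltW.
have am : admissible c m.
  by split=> [_|]; [exact: ltW|move/(lt_trans c0); rewrite ltxx].
rewrite /= admissible_pbasis_ge0 ?(ltW x0)//= pbasisE weightDn// /weight (gt_eqF c0).
have -> : (1 + c * x)^-1 `^ (m / c) = (1 + c * x) `^ (- (m / c)).
  by rewrite -powR_inv1 ?ltW// -powRrM mulN1r.
set w := _ `^ _; have w0 : 0 <= w by exact: powR_ge0.
have q0 : 0 <= rfact c m l / l`!%:R.
  by rewrite divr_ge0// rfact_ge0// => [_|]; [exact: ltW|move/(lt_trans c0); rewrite ltxx].
rewrite /C -!mulrA (mulrA _ _ (x ^+ l * _)) [leRHS]mulrA ler_wpM2l//.
rewrite [leRHS]mulrC mulrCA ler_wpM2l// ler_pdivrMr ?exprn_gt0// mulrC.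
rewrite ler_pdivlMr ?exprn_gt0// -exprMn lerXn2r ?nnegrE ?mulr_ge0 ?(ltW x0) ?(ltW x1) ?(ltW c0)//.
by rewrite mulrC lerDr.
Unshelve. all: by end_near. Qed.

Lemma cvg_pinfty_psum c m N : 0 <= c -> 0 < m ->
  psum c m N x @[x --> +oo] --> 0.
Proof.
move=> c0 m0; elim: N => [|N IH].
  rewrite (_ : psum c m 0 = pbasis c m 0); first exact: cvg_pinfty_pbasis.
  by apply/funext => y; rewrite /psum big_ord_recl big_ord0 addr0.
rewrite (_ : psum c m N.+1 = psum c m N + pbasis c m N.+1); last first.
  by apply/funext => y; rewrite /psum big_ord_recr.
by rewrite -[X in _ --> X]addr0; apply: cvgD => //; exact: cvg_pinfty_pbasis.
Qed.

Lemma integrable_basis_admissible c m l : integrable_basis c m l -> admissible c m.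
Proof.
move=> [h1 h2]; split=> [c0|/h2[M]]; first by rewrite (le_trans c0)// ltW// h1.
by exists M.
Qed.

Lemma integrable_basis_gt0 c m l : integrable_basis c m l -> 0 < m - c.
Proof.
move=> [h1 h2]; rewrite subr_gt0; case: (leP 0 c) => c0; first exact: h1.
by have [M -> _] := h2 c0; rewrite (lt_le_trans c0)// mulr_ge0// oppr_ge0 ltW.
Qed.

Lemma admissibleB c m l : integrable_basis c m l -> admissible c (m - c).
Proof.
move=> ib; split=> [_|c0]; first exact: ltW (integrable_basis_gt0 ib).
have [M -> _] := ib.2 c0; exists M.+1; rewrite -addn1 natrD; ring.
Qed.

(** The function [F] built from [psum c (m - c) l] is a primitive. It equals [- (m - c)^-1] at 0 and
    vanishes at the right end of [Ic c], whether this is infinity or [- 1 / c]. *)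
Lemma ge0_integral_pbasis c m l : integrable_basis c m l ->
  (\int[mu]_(x in Ic c) (pbasis c m l x)%:E = ((m - c)^-1)%:E)%E.
Proof.
move=> ib; have am := integrable_basis_admissible ib.
have am' := admissibleB ib; have mc := integrable_basis_gt0 ib.
set F := fun x => - (m - c)^-1 * psum c (m - c) l x.
have dF x : 0 < 1 + c * x -> is_derive x 1 F (pbasis c m l x).
  move=> /(is_derive_psum (m - c) l); rewrite subrK => d.
  have := is_deriveZ (- (m - c)^-1) d; move/is_derive_eq; apply.
  by rewrite /GRing.scale/=; field; rewrite gt_eqF.
have F0 : F 0 = - (m - c)^-1 by rewrite /F psum_x0 mulr1.
have cF x : 0 < 1 + c * x -> {for x, continuous F}.
  by move=> /dF[d _]; apply/differentiable_continuous/derivable1_diffP.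
have cp := @admissible_continuous_pbasis _ c m l am.
case: (leP 0 c) => c0.
  have Iy : Ic c = `[0, +oo[%classic by rewrite /Ic c0.
  have x1 x : 0 <= x -> 0 < 1 + c * x by move=> ?; rewrite ltr_pwDl// mulr_ge0.
  rewrite Iy (@ge0_continuous_FTC2y _ (pbasis c m l) F 0 0).
  - by rewrite F0 -EFinB sub0r opprK.
  - by move=> x x0; exact: admissible_pbasis_ge0.
  - by rewrite -Iy.
  - rewrite -(mulr0 (- (m - c)^-1)); apply: cvgM; first exact: cvg_cst.
    exact: cvg_pinfty_psum.
  - by move=> x /ltW/x1/dF[].
  - by apply: cvg_at_right_filter; apply: cF; exact: x1.
  - move=> x; rewrite in_itv/= andbT => /ltW/x1/dF d.
    by rewrite derive1E; exact: derive_val.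
have [M mM lM] := ib.2 c0; have b0 : 0 < - 1 / c by rewrite ltr_ndivlMr// mul0r; lra.
have Ib : Ic c = `[0, - 1 / c]%classic by rewrite /Ic leNgt c0.
have Icb : Ic c (- 1 / c) by rewrite Ib /= in_itv/= lexx ltW.
have x1 x : x \in `]0, - 1 / c[%R -> 0 < 1 + c * x.
  by rewrite in_itv/= => /andP[x0 xb]; apply: (Ic_lt Icb); rewrite (ltW x0).
(* Each summand carries the base 0 to the exponent [M.+1 - j], which is positive because
   [j <= l <= M]. *)
have Fb : F (- 1 / c) = 0.
  rewrite /F /psum big1 ?mulr0// => -[j jl] _ /=; rewrite pbasisE /weight (lt_eqF c0).
  rewrite (_ : 1 + c * (- 1 / c) = 0); last by field; rewrite lt_eqF.
  rewrite powR0 ?mulr0//.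
  have -> : - ((m - c + c * j%:R) / c) = (M.+1 - j)%:R.
    rewrite natrB; last by rewrite (leq_trans _ (leqW lM))// -ltnS ltnW.
    by rewrite mM -addn1 natrD; field; rewrite lt_eqF.
  by rewrite pnatr_eq0 subn_eq0 -ltnNge ltnS (leq_trans _ lM)// -ltnS.
have cpb := cp; rewrite Ib in cpb.
rewrite Ib (@continuous_FTC2 _ (pbasis c m l) F 0 (- 1 / c))//.
- by rewrite F0 Fb -EFinB sub0r opprK.
- have : {within `[0, - 1 / c], continuous F}.
    have := @continuous_psum _ _ _ l am'; rewrite Ib => cps.
    by move=> x; apply: cvgM; [exact: cvg_cst|exact: cps].
  move=> /(continuous_within_itvP _ b0)[_ h1 h2]; split=> //.
  by move=> x /x1/dF[].
- by move=> x /x1/dF d; rewrite derive1E; exact: derive_val.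
Qed.

Lemma integrable_pbasis c m l : integrable_basis c m l ->
  mu.-integrable (Ic c) (EFin \o pbasis c m l).
Proof.
move=> ib; have am := integrable_basis_admissible ib.
apply/integrableP; split.
  apply/measurable_EFinP; apply: subspace_continuous_measurable_fun.
    exact: measurable_Ic.
  exact: admissible_continuous_pbasis.
under eq_integral => x /set_mem/Ic_ge0 x0.
  by rewrite /= ger0_norm; [|exact: admissible_pbasis_ge0]; over.
by rewrite ge0_integral_pbasis// ltry.
Qed.

Lemma Rintegral_pbasis c m l : integrable_basis c m l ->
  \int[mu]_(x in Ic c) pbasis c m l x = (m - c)^-1.
Proof. by move=> ib; rewrite /Rintegral ge0_integral_pbasis. Qed.

End BasisIntegral.

(** * Taylor's inequality with one-sided derivatives *)

Section Taylor.
Variables (R : realType) (I : set R).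
Hypothesis segI : forall x y z : R, I x -> I y -> x <= z <= y -> I z.
Implicit Types (f : R -> R) (x y z a t K : R).

(** A small ball around a point strictly between two points of [I] lies in [I], so there the
    relative derivative is the ordinary one and the library's mean value theorem applies. *)
Lemma derivable_in_is_derive f x y z : I x -> I y -> x < z < y ->
  derivable_in I f z -> is_derive z 1 f (derive_in I f z).
Proof.
move=> Ix Iy /andP[xz zy] df.
have h : h^-1 *: ((f \o shift z) (h *: (1:R)) - f z) @[h --> 0^'] --> derive_in I f z.
  move=> A /df /nbhs_ballP[e /= e0 hA]; apply/nbhs_ballP.
  exists (Num.min e (Num.min (z - x) (y - z))) => /=.
    by rewrite !lt_min e0 !subr_gt0 xz zy.
  move=> d; rewrite /ball /= sub0r normrN !lt_min => /and3P[de dx dy] d0.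
  have [dx1 dx2] := ltr_normlP _ _ dx; have [dy1 dy2] := ltr_normlP _ _ dy.
  rewrite /= [_%:A]mulr1.
  have -> : d^-1 *: (f (d + z) - f z) = slope f z (d + z).
    by rewrite /slope addrK mulrC.
  apply: hA; first by rewrite /ball /= opprD addrCA subrr addr0 normrN.
    by rewrite -subr_eq0 addrK.
  by apply: (segI Ix Iy); apply/andP; split; lra.
apply: DeriveDef; first exact: cvgP h.
exact: (cvg_lim _ h).
Qed.

Lemma derivable_in_continuous f : (forall x, I x -> derivable_in I f x) ->
  {within I, continuous f}.
Proof.
move=> df; apply/subspace_continuousP => x Ix.
have /cvgrPdist_lt/(_ 1 ltr01)/nbhs_ballP[e /= e0 he] := df x Ix.
set L := lim _ in he; pose M := `|L| + 1.
have M0 : 0 < M by rewrite ltr_wpDl.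
apply/cvgrPdist_lt => r r0; apply/nbhs_ballP.
exists (Num.min e (r / M)) => /=; first by rewrite lt_min e0 divr_gt0.
move=> y; rewrite /ball /= lt_min => /andP[ye yr] Iy.
have [->|yx] := eqVneq y x; first by rewrite subrr normr0.
have hs := he y ye yx Iy.
have sM : `|slope f x y| < M.
  rewrite /M addrC -ltrBlDr; apply: le_lt_trans hs.
  by rewrite distrC lerB_dist.
have -> : f x - f y = - (slope f x y * (y - x)).
  by rewrite /slope divfK ?opprB// subr_eq0.
rewrite normrN normrM distrC.
by rewrite (le_lt_trans (ler_wpM2r _ (ltW sM)))// mulrC -ltr_pdivlMr.
Qed.

Lemma MVT_in (h dh : R -> R) x y : I x -> I y -> x < y ->
  {within I, continuous h} ->
  (forall z, x < z < y -> is_derive z 1 h (dh z)) ->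
  exists2 z, x < z < y & h y - h x = dh z * (y - x).
Proof.
move=> Ix Iy xy ch dhh.
have hd z : z \in `]x, y[%R -> is_derive z 1 h (dh z).
  by rewrite in_itv; exact: dhh.
have hc : {within `[x, y], continuous h}.
  by apply: continuous_subspaceW ch => z /=; rewrite in_itv/=; exact: segI.
by have [z] := MVT xy hd hc; rewrite in_itv => xz e; exists z.
Qed.

Lemma derive_in_lipschitz g K x y : (forall x, I x -> derivable_in I g x) ->
  (forall x, I x -> `|derive_in I g x| <= K) -> I x -> I y ->
  `|g y - g x| <= K * `|y - x|.
Proof.
move=> dg gK; wlog xy : x y / x < y => [hw|] Ix Iy.
  have [xy|yx|->] := ltgtP x y; [exact: hw| |by rewrite !subrr normr0 mulr0].
  by rewrite distrC [X in _ * X]distrC; exact: hw.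
have [z xzy ->] := MVT_in Ix Iy xy (derivable_in_continuous dg)
  (fun z xzy => derivable_in_is_derive Ix Iy xzy
     (dg z (segI Ix Iy (introT andP (conj (ltW (proj1 (andP xzy))) (ltW (proj2 (andP xzy)))))))).
rewrite normrM ler_wpM2r// gK//; move: xzy => /andP[xz zy].
by apply: (segI Ix Iy); rewrite !ltW.
Qed.

(** The sign [s] covers both one-sided bounds. The auxiliary [h] is maximal at [a]: as
    [derive_in I f] is [K]-Lipschitz, the derivative [dh] is nonnegative to the left of [a] and
    nonpositive to the right. *)
Lemma taylor_le f K s a t : (s == 1) || (s == -1) ->
  (forall x, I x -> derivable_in I f x) ->
  (forall x, I x -> derivable_in I (derive_in I f) x) ->
  (forall x, I x -> `|derive_in I (derive_in I f) x| <= K) -> I a -> I t ->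
  s * (f t - (f a + derive_in I f a * (t - a))) <= K / 2 * (t - a) ^+ 2.
Proof.
move=> s1 df dg gK Ia It; set g := derive_in I f.
pose h x := s * (f x - g a * x) - K / 2 * (x - a) ^+ 2.
pose dh x := s * (g x - g a) - K * (x - a).
suff : h t <= h a by rewrite /h subrr expr0n /= mulr0; lra.
have lip z : I z -> - (K * `|z - a|) <= s * (g z - g a) <= K * `|z - a|.
  move=> Iz; rewrite -ler_norml normrM.
  have -> : `|s| = 1 by case/orP: s1 => /eqP ->; rewrite ?normrN normr1.
  by rewrite mul1r; exact: derive_in_lipschitz dg gK Ia Iz.
have dh' z x y : I x -> I y -> x < z < y -> is_derive z 1 h (dh z).
  move=> Ix Iy xzy; have Iz : I z.
    by move: xzy => /andP[? ?]; apply: (segI Ix Iy); rewrite !ltW.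
  have dz := derivable_in_is_derive Ix Iy xzy (df z Iz).
  by apply: is_derive_eq; rewrite /GRing.scale /= /dh -/g; field.
have ch : {within I, continuous h}.
  pose q := fun x : R => - (s * (g a * x)) - K / 2 * (x - a) ^+ 2.
  have cq : continuous q.
    by move=> y; apply/differentiable_continuous/derivable1_diffP/ex_derive.
  have -> : h = (fun x => s * f x) \+ q.
    by apply/funext => x; rewrite /h /q /=; ring.
  apply: within_continuousD; last exact: continuous_subspaceT.
  move=> x; apply: cvgM; first exact: cvg_cst.
  exact: derivable_in_continuous df x.
have [ta|ta|->//] := ltgtP t a.
  have [z tza e] := MVT_in It Ia ta ch (fun z => dh' z t a It Ia).
  have Iz : I z by move: tza => /andP[? ?]; apply: (segI It Ia); rewrite !ltW.
  rewrite -subr_ge0 e mulr_ge0 ?subr_ge0 ?(ltW ta)// /dh.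
  move: (lip z Iz) tza => /andP[l _] /andP[_ za].
  by rewrite (le_trans _ l)// ltr0_norm ?subr_lt0// mulrN opprK.
have [z atz e] := MVT_in Ia It ta ch (fun z => dh' z a t Ia It).
have Iz : I z by move: atz => /andP[? ?]; apply: (segI Ia It); rewrite !ltW.
rewrite -subr_le0 e mulr_le0_ge0 ?subr_ge0 ?(ltW ta)// /dh.
move: (lip z Iz) atz => /andP[_ l] /andP[az _].
by rewrite subr_le0 (le_trans l)// gtr0_norm ?subr_gt0.
Qed.

Lemma taylor_in f K a t : (forall x, I x -> derivable_in I f x) ->
  (forall x, I x -> derivable_in I (derive_in I f) x) ->
  (forall x, I x -> `|derive_in I (derive_in I f) x| <= K) -> I a -> I t ->
  `|f t - (f a + derive_in I f a * (t - a))| <= K / 2 * (t - a) ^+ 2.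
Proof.
move=> df dg gK Ia It; rewrite ler_norml; apply/andP; split.
  by have := @taylor_le f K (-1) a t _ df dg gK Ia It; rewrite eqxx orbT => /(_ isT); lra.
by have := @taylor_le f K 1 a t _ df dg gK Ia It; rewrite eqxx => /(_ isT); lra.
Qed.

End Taylor.

(** * Integral moments of a single basis function *)

Section BasisMoments.
Variable R : realType.
Let mu := @lebesgue_measure R.
Implicit Types (c m u v K a : R) (l : nat) (f : R -> R).

Lemma integrable_basisB c m l : integrable_basis c m l ->
  (0 <= c -> c < m - c) -> integrable_basis c (m - c) l.+1.
Proof.
move=> [_ h2] h; split=> // /h2[M -> lM]; exists M.+1 => //.
by rewrite -addn1 natrD; ring.
Qed.

Lemma Rintegral_mulr_pbasis c m l : integrable_basis c m l ->
  (0 <= c -> 2 * c < m) ->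
  mu.-integrable (Ic c) (EFin \o (fun t => t * pbasis c m l t)) /\
  \int[mu]_(t in Ic c) (t * pbasis c m l t) =
    (l%:R + 1) / ((m - c) * (m - 2 * c)).
Proof.
move=> ib h; have mc := integrable_basis_gt0 ib.
have ib' : integrable_basis c (m - c) l.+1.
  by apply: integrable_basisB => // c0; have := h c0; lra.
have mc' := integrable_basis_gt0 ib'.
have mnc : m != c by rewrite -subr_eq0 gt_eqF.
have -> : (fun t => t * pbasis c m l t) =
    (fun t => (l%:R + 1) / (m - c) * pbasis c (m - c) l.+1 t).
  by apply/funext => t; exact: mulr_pbasis.
have i' := integrable_pbasis ib'; have mI := measurable_Ic c.
split; first exact: integrable_scale.
rewrite RintegralZl// Rintegral_pbasis//; field.
by rewrite !gt_eqF//; move: mc'; rewrite -addrA -opprD mulr_natl.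
Qed.

Lemma Rintegral_sqr_pbasis c m l : integrable_basis c m l ->
  (0 <= c -> 3 * c < m) ->
  mu.-integrable (Ic c) (EFin \o (fun t => t * (t * pbasis c m l t))) /\
  \int[mu]_(t in Ic c) (t * (t * pbasis c m l t)) =
    (l%:R + 1) * (l%:R + 2) / ((m - c) * (m - 2 * c) * (m - 3 * c)).
Proof.
move=> ib h; have mc := integrable_basis_gt0 ib.
have ib' : integrable_basis c (m - c) l.+1.
  by apply: integrable_basisB => // c0; have := h c0; lra.
have mc' := integrable_basis_gt0 ib'.
have ib2 : integrable_basis c (m - c - c) l.+2.
  by apply: integrable_basisB => // c0; have := h c0; lra.
have mc2 := integrable_basis_gt0 ib2.
have mnc : m != c by rewrite -subr_eq0 gt_eqF.
have [|i' e'] := Rintegral_mulr_pbasis ib'; first by move=> c0; have := h c0; lra.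
have -> : (fun t => t * (t * pbasis c m l t)) =
    (fun t => (l%:R + 1) / (m - c) * (t * pbasis c (m - c) l.+1 t)).
  by apply/funext => t; rewrite mulr_pbasis// mulrCA.
have mI := measurable_Ic c.
split; first exact: integrable_scale.
rewrite RintegralZl// e' -addn1 natrD; field.
rewrite !gt_eqF//; lra.
Qed.

Lemma basis_integral_bound c m l f u v K a : integrable_basis c m l ->
  (0 <= c -> 3 * c < m) -> measurable_fun (Ic c) f ->
  (forall t, Ic c t -> `|f t - (u + v * t)| <= K * (t - a) ^+ 2) ->
  `| (m - c) * \int[mu]_(t in Ic c) (pbasis c m l t * f t)
     - (u + v * ((l%:R + 1) / (m - 2 * c))) |
  <= K * ((l%:R + 1) * (l%:R + 2) / ((m - 2 * c) * (m - 3 * c))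
          - 2 * a * ((l%:R + 1) / (m - 2 * c)) + a ^+ 2).
Proof.
move=> ib h mf hf; have mc := integrable_basis_gt0 ib.
have [|i1 e1] := Rintegral_mulr_pbasis ib.
  by move=> c0; have := h c0; lra.
have [i2 e2] := Rintegral_sqr_pbasis ib h.
have p0 t : Ic c t -> 0 <= pbasis c m l t.
  by move/Ic_ge0; apply: admissible_pbasis_ge0; exact: integrable_basis_admissible ib.
have mid : measurable_fun (Ic c) (id : R -> R).
  apply: subspace_continuous_measurable_fun; first exact: measurable_Ic.
  by apply: continuous_subspaceT => x; exact: cvg_id.
have := @weighted_integral_bound _ _ R mu (Ic c) id (pbasis c m l) f u v K a
  (measurable_Ic c) p0 (integrable_pbasis ib) i1 i2 mid mf hf.
rewrite e1 e2 Rintegral_pbasis// => H.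
have := ler_wpM2l (ltW mc) H.
rewrite -{1}(gtr0_norm mc) -normrM.
have mc2 : m - 2 * c != 0.
  rewrite gt_eqF//; case: (leP 0 c) => [c0|c0]; first by have := h c0; lra.
  by rewrite (lt_trans mc)//; lra.
have mc3 : m - 3 * c != 0.
  rewrite gt_eqF//; case: (leP 0 c) => [c0|c0]; first by have := h c0; lra.
  by rewrite (lt_trans mc)//; lra.
have mc1 : m - c != 0 by rewrite gt_eqF.
set X := \int[mu]_(t in _) _.
have -> : (m - c) * (X - (u / (m - c) + v * ((l%:R + 1) / ((m - c) * (m - 2 * c)))))
  = (m - c) * X - (u + v * ((l%:R + 1) / (m - 2 * c))).
  by field; rewrite mc1 mc2.
move/le_trans; apply; rewrite le_eqVlt; apply/orP; left; apply/eqP.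
by field; rewrite mc1 mc2 mc3.
Qed.

End BasisMoments.

(** * The functionals [A_j] *)

Section Functional.
Variables (R : realType) (c n : R) (k rho : nat).
Hypotheses (hn_neg : c < 0 -> exists N : nat, (0 < N)%N /\ - n / c = N%:R)
  (hk : (0 < k)%N) (hrho : (0 < rho)%N) (hk_neg : c < 0 -> k%:R < - n / c)
  (hnrho : (k%:R + 1) * c < n * rho%:R).
Let mu := @lebesgue_measure R.
Let m := n * rho%:R - (k%:R - 2) * c.
Let idx (j : nat) (i : {ffun 'I_k -> 'I_rho}) : nat := (j * rho + \sum_(s < k) i s + k.-1)%N.
Implicit Types (j : nat) (i : {ffun 'I_k -> 'I_rho}) (u v K a x : R) (f : R -> R).

Lemma neg_nE : c < 0 -> exists2 N : nat, n = - c * N%:R & (k < N)%N.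
Proof.
move=> c0; have [N [_ e]] := hn_neg c0; exists N.
  by rewrite -e; field; rewrite lt_eqF.
by have := hk_neg c0; rewrite e ltr_nat.
Qed.

Lemma inJ_neg j (N : nat) : c < 0 -> n = - c * N%:R -> inJ c n k j = (j + k <= N)%N.
Proof.
move=> c0 e; rewrite /inJ leNgt c0 /= e lerBrDr -natrD.
have -> : - (- c * N%:R) / c = N%:R by field; rewrite lt_eqF.
by rewrite ler_nat.
Qed.

Lemma sum_ffun_le i : (\sum_(s < k) i s <= k * rho.-1)%N.
Proof.
apply: (@leq_trans (\sum_(s < k) rho.-1)); last by rewrite sum_nat_const card_ord.
by apply: leq_sum => s _; rewrite -ltnS prednK.
Qed.

Lemma integrable_basis_idx j i : inJ c n k j -> integrable_basis c m (idx j i).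
Proof.
move=> jJ; split=> [c0|c0]; first by move: hnrho; rewrite /m; nra.
(* With [n = - c * N] one gets [m = - c * (N * rho + k - 2)]. The largest index is [j * rho + k *
   (rho - 1) + k - 1 = (j + k) * rho - 1], at most [N * rho - 1], and [k] is positive. *)
have [N nN kN] := neg_nE c0; exists (N * rho + k - 2)%N.
  rewrite natrB; last by nia.
  by rewrite natrD natrM /m nN; ring.
move: jJ; rewrite (inJ_neg _ c0 nN) => jN; have := sum_ffun_le i.
rewrite /idx; set S := (\sum_(s < k) _)%N; clearbody S.
have h : (j * rho + k * rho <= N * rho)%N by rewrite -mulnDl leq_mul2r jN orbT.
by rewrite -(prednK hrho) in h *; nia.
Qed.

(** Since [n * rho - (k - 1) * c = m - c], the functional is the plain average of [rho ^ k]
    normalized basis functionals, so bounds for one of them pass to [Afun]. *)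
Lemma Afun_meanE j f : Afun c n k rho j f = (rho%:R ^+ k)^-1 *
  \sum_i ((m - c) * \int[mu]_(t in Ic c) (pbasis c m (idx j i) t * f t)).
Proof.
rewrite /Afun -mulr_sumr [RHS]mulrA [X in _ = X * _]mulrC.
by congr (_ / _ * _); rewrite /m; ring.
Qed.

Lemma card_idx : #|{ffun 'I_k -> 'I_rho}|%:R = rho%:R ^+ k :> R.
Proof. by rewrite card_ffun !card_ord natrX. Qed.

Lemma rhoX_neq0 : rho%:R ^+ k != 0 :> R.
Proof. by rewrite expf_neq0// pnatr_eq0 -lt0n. Qed.

Lemma mean_cst a : (rho%:R ^+ k)^-1 * \sum_(i : {ffun 'I_k -> 'I_rho}) a = a.
Proof. rewrite sumr_const -[a *+ _]mulr_natl (_ : #|_|%:R = rho%:R ^+ k); last exact: card_idx.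
by rewrite mulrA mulVf ?mul1r// rhoX_neq0. Qed.

Lemma lt_3c_param : 0 <= c -> 3 * c < m.
Proof. by move: hnrho => h c0; rewrite /m; nra. Qed.

Lemma subr_kc_gt0 : 0 < n * rho%:R - k%:R * c.
Proof.
case: (leP 0 c) => c0; first by move: hnrho; nra.
have [N -> kN] := neg_nE c0.
have -> : - c * N%:R * rho%:R - k%:R * c = - c * (N * rho + k)%:R.
  by rewrite natrD natrM; ring.
by rewrite mulr_gt0 ?oppr_gt0// ltr0n addn_gt0 hk orbT.
Qed.

Lemma subr_k1c_gt0 : 0 < n * rho%:R - (k%:R + 1) * c.
Proof. by rewrite subr_gt0. Qed.

Lemma param_sub2c_neq0 : m - 2 * c != 0.
Proof. by rewrite (_ : _ - _ = n * rho%:R - k%:R * c) ?gt_eqF ?subr_kc_gt0// /m; ring. Qed.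

Lemma param_sub3c_neq0 : m - 3 * c != 0.
Proof. by rewrite (_ : _ - _ = n * rho%:R - (k%:R + 1) * c) ?gt_eqF ?subr_k1c_gt0// /m; ring. Qed.

Lemma Afun_emon1 j : inJ c n k j -> Afun c n k rho j (@emon R 1) =
  (rho%:R ^+ k)^-1 * \sum_i (((idx j i)%:R + 1) / (m - 2 * c)).
Proof.
move=> jJ; rewrite Afun_meanE; congr (_ * _); apply: eq_bigr => i _.
have ib := integrable_basis_idx i jJ; have mc := integrable_basis_gt0 ib.
have [|_] := Rintegral_mulr_pbasis ib; first by move=> c0; have := lt_3c_param c0; lra.
have -> : \int[mu]_(t in Ic c) (t * pbasis c m (idx j i) t) =
   \int[mu]_(t in Ic c) (pbasis c m (idx j i) t * emon 1 t).
  by apply: eq_Rintegral => t _; rewrite /emon; ring.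
move=> ->; have := lt0r_neq0 mc; have := param_sub2c_neq0.
set d1 := m - c; set d2 := m - 2 * c => d20 d10; clearbody d1 d2.
by field; rewrite d10 d20.
Qed.

Lemma Afun_emon2 j : inJ c n k j -> Afun c n k rho j (@emon R 2) =
  (rho%:R ^+ k)^-1 * \sum_i
    (((idx j i)%:R + 1) * ((idx j i)%:R + 2) / ((m - 2 * c) * (m - 3 * c))).
Proof.
move=> jJ; rewrite Afun_meanE; congr (_ * _); apply: eq_bigr => i _.
have ib := integrable_basis_idx i jJ; have mc := integrable_basis_gt0 ib.
have [_] := Rintegral_sqr_pbasis ib lt_3c_param.
have -> : \int[mu]_(t in Ic c) (t * (t * pbasis c m (idx j i) t)) =
   \int[mu]_(t in Ic c) (pbasis c m (idx j i) t * emon 2 t).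
  by apply: eq_Rintegral => t _; rewrite /emon; ring.
move=> ->; have := lt0r_neq0 mc; have := param_sub2c_neq0; have := param_sub3c_neq0.
set d1 := m - c; set d2 := m - 2 * c; set d3 := m - 3 * c => d30 d20 d10.
by clearbody d1 d2 d3; field; rewrite d10 d20 d30.
Qed.

Lemma Afun_bound j f u v K a : inJ c n k j -> measurable_fun (Ic c) f ->
  (forall t, Ic c t -> `|f t - (u + v * t)| <= K * (t - a) ^+ 2) ->
  `|Afun c n k rho j f - (u + v * Afun c n k rho j (@emon R 1))|
  <= K * (Afun c n k rho j (@emon R 2)
          - 2 * a * Afun c n k rho j (@emon R 1) + a ^+ 2).
Proof.
move=> jJ mf hf; rewrite Afun_emon1// Afun_emon2// Afun_meanE.
pose q := (rho%:R ^+ k)^-1 : R; have q0 : 0 <= q by rewrite invr_ge0 exprn_ge0.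
pose T i := (m - c) * \int[mu]_(t in Ic c) (pbasis c m (idx j i) t * f t).
pose E1 i := ((idx j i)%:R + 1) / (m - 2 * c).
pose E2 i := ((idx j i)%:R + 1) * ((idx j i)%:R + 2) / ((m - 2 * c) * (m - 3 * c)).
change (`|q * \sum_i T i - (u + v * (q * \sum_i E1 i))| <=
  K * (q * \sum_i E2 i - 2 * a * (q * \sum_i E1 i) + a ^+ 2)).
have hT i : `|T i - (u + v * E1 i)| <= K * (E2 i - 2 * a * E1 i + a ^+ 2).
  by apply: basis_integral_bound lt_3c_param mf hf; exact: integrable_basis_idx.
clearbody T E1 E2.
have -> : q * \sum_i T i - (u + v * (q * \sum_i E1 i)) =
    q * \sum_i (T i - (u + v * E1 i)).
  rewrite sumrB big_split /= -mulr_sumr mulrBr mulrDr mean_cst.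
  by rewrite (mulrCA q v).
have -> : K * (q * \sum_i E2 i - 2 * a * (q * \sum_i E1 i) + a ^+ 2) =
    q * \sum_i (K * (E2 i - 2 * a * E1 i + a ^+ 2)).
  rewrite -mulr_sumr big_split /= sumrB -mulr_sumr !mulrDr mulrN.
  by rewrite (mulrCA q K (\sum_i a ^+ 2)) mean_cst; ring.
rewrite normrM (ger0_norm q0) ler_wpM2l// (le_trans (ler_norm_sum _ _ _))//.
by apply: ler_sum => i _; exact: hT.
Qed.

(** Reversing every coordinate, [i s] to [rho - 1 - i s], permutes the functions and replaces the
    sum [S] by [rho ^ k * k * (rho - 1) - S]. *)
Lemma sum_idx :
  \sum_(i : {ffun 'I_k -> 'I_rho}) (\sum_(s < k) i s)%:R =
  rho%:R ^+ k * (k%:R * (rho%:R - 1)) / 2 :> R.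
Proof.
set S := LHS.
pose r i : {ffun 'I_k -> 'I_rho} := [ffun s => rev_ord (i s)].
have rK : involutive r by move=> i; apply/ffunP => s; rewrite !ffunE rev_ordK.
have e : S = \sum_(i : {ffun 'I_k -> 'I_rho}) (k%:R * (rho%:R - 1) - (\sum_(s < k) i s)%:R).
  rewrite /S (reindex_inj (inv_inj rK)); apply: eq_bigr => i _.
  have -> : k%:R * (rho%:R - 1) = \sum_(s < k) (rho%:R - 1) :> R.
    by rewrite sumr_const card_ord mulr_natl.
  rewrite !natr_sum -sumrB; apply: eq_bigr => s _.
  rewrite ffunE /= natrB; last exact: ltn_ord.
  by rewrite -addn1 natrD; ring.
move: e; rewrite sumrB sumr_const -[_ *+ #|_|]mulr_natl (_ : #|_|%:R = rho%:R ^+ k); last exact: card_idx.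
rewrite -/S; lra.
Qed.

Lemma bptE j : inJ c n k j -> bpt c n k rho j =
  ((2 * j%:R + k%:R) * rho%:R + k%:R) / (2 * (n * rho%:R - k%:R * c)).
Proof.
move=> jJ; rewrite /bpt Afun_emon1// -mulr_suml mulrA.
have -> : \sum_i ((idx j i)%:R + 1 : R) =
   \sum_(i : {ffun 'I_k -> 'I_rho}) (j%:R * rho%:R + k%:R : R) +
   \sum_(i : {ffun 'I_k -> 'I_rho}) (\sum_(s < k) i s)%:R.
  rewrite -big_split; apply: eq_bigr => i _ /=.
  rewrite /idx !natrD natrM addrAC -!addrA; congr (_ + _); rewrite addrC; congr (_ + _).
  by rewrite addrC natr1 prednK.
rewrite mulrDr mean_cst sum_idx.
have -> : m - 2 * c = n * rho%:R - k%:R * c by rewrite /m; ring.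
have := subr_kc_gt0; have := rhoX_neq0; set q := _ ^+ _; set d := _ - _ => q0 d0.
by clearbody q d; field; rewrite q0 gt_eqF.
Qed.

(** The constant is crude; only the quadratic growth in [j] matters, for the convergence of the
    series. *)
Lemma Afun_emon2_le j : inJ c n k j ->
  0 <= Afun c n k rho j (@emon R 2) <=
  (rho + k * rho + k + 1)%:R ^+ 2 / ((m - 2 * c) * (m - 3 * c)) * j.+1%:R ^+ 2.
Proof.
move=> jJ; rewrite Afun_emon2//.
have d0 : 0 <= ((m - 2 * c) * (m - 3 * c))^-1.
  rewrite invr_ge0 mulr_ge0//.
    by rewrite (le_trans (ltW subr_kc_gt0))// /m; lra.
  by rewrite (le_trans (ltW subr_k1c_gt0))// /m; lra.
have q0 : 0 <= (rho%:R ^+ k)^-1 :> R by rewrite invr_ge0 exprn_ge0.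
apply/andP; split.
  by rewrite mulr_ge0// sumr_ge0// => i _; rewrite mulr_ge0// mulr_ge0// addr_ge0.
rewrite -[leRHS]mean_cst ler_wpM2l// ler_sum// => i _.
rewrite [leRHS]mulrAC ler_wpM2r// -exprMn -natrM.
have h : (idx j i + 2 <= (rho + k * rho + k + 1) * j.+1)%N.
  have := sum_ffun_le i; rewrite /idx; set S := (\sum_(s < k) _)%N; clearbody S.
  by rewrite -(prednK hk) -(prednK hrho) /=; nia.
move: h; rewrite -(ler_nat R) natrD => h.
by rewrite expr2 ler_pM ?addr_ge0// (le_trans _ h)// lerD2l ler1n.
Qed.
End Functional.

(** * The operators *)

Section Series.
Variables (R : realType) (c n : R) (k rho : nat).
Hypotheses (hn_nneg : 0 <= c -> c < n)
  (hn_neg : c < 0 -> exists N : nat, (0 < N)%N /\ - n / c = N%:R)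
  (hk : (0 < k)%N) (hrho : (0 < rho)%N) (hk_neg : c < 0 -> k%:R < - n / c)
  (hnrho : (k%:R + 1) * c < n * rho%:R).
Variable x : R.
Hypothesis Ix : Ic c x.
Implicit Types (g h : nat -> R) (a b C : R) (j : nat).

Let p j := pbasis c (n + k%:R * c) j x.
Let J j := inJ c n k j.

Definition basis_mean g : R := limn (series (fun j => g j * p j)).

(** Coefficient sequences whose basis series converges. Only indices in [J] are constrained; outside
    [J] the basis function at [x] is zero. *)
Definition quadratic_growth g : Prop :=
  exists C, forall j, J j -> `|g j| <= C * j.+1%:R ^+ 2.

Lemma admissible_nDkc : admissible c (n + k%:R * c).
Proof.
split=> [c0|c0]; first by rewrite addr_ge0 ?mulr_ge0// (le_trans c0)// ltW// hn_nneg.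
have [N -> kN] := neg_nE hn_neg hk_neg c0; exists (N - k)%N.
by rewrite natrB 1?ltnW//; ring.
Qed.

Lemma basis_ge0 j : 0 <= p j.
Proof. by apply: admissible_pbasis_ge0 (Ic_ge0 Ix); exact: admissible_nDkc. Qed.

Lemma basis_off_J j : ~~ J j -> p j = 0.
Proof.
case: (leP 0 c) => c0; first by rewrite /J /inJ c0.
have [N nN kN] := neg_nE hn_neg hk_neg c0.
rewrite /J (inJ_neg _ _ c0 nN) -ltnNge => jN; apply: (@pbasis_eq0 _ _ _ (N - k)%N).
  by rewrite nN natrB 1?ltnW//; ring.
by move: jN kN; clear; lia.
Qed.

Lemma sum_J_basis g :
  \big[+%R/0]_(0 <= j <oo | inJ c n k j) (g j * pbasis c (n + k%:R * c) j x) =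
  basis_mean g.
Proof.
rewrite /basis_mean; congr (limn _); apply/funext => N.
rewrite /series /= [RHS](bigID J)/= [X in _ = _ + X]big1 ?addr0// => j.
by move/basis_off_J => ->; rewrite mulr0.
Qed.

Lemma quadratic_growth_cvg g : quadratic_growth g ->
  cvgn (series (fun j => g j * p j)).
Proof.
move=> [C hC]; apply: (is_cvg_series_pbasis (C := C)) => //.
  exact: admissible_nDkc.
move=> j; case: (boolP (J j)) => [/hC//|/basis_off_J pj].
by rewrite -/(p j) pj eqxx.
Qed.

Lemma quadratic_growth_lin a b g h : quadratic_growth g -> quadratic_growth h ->
  quadratic_growth (fun j => a * g j + b * h j).
Proof.
move=> [C hC] [D hD]; exists (`|a| * C + `|b| * D) => j Jj.
rewrite (le_trans (ler_normD _ _))// mulrDl !normrM -!mulrA.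
by rewrite lerD// ler_wpM2l// ?hC ?hD.
Qed.

Lemma quadratic_growth_le g h : quadratic_growth h ->
  (forall j, J j -> `|g j| <= `|h j|) -> quadratic_growth g.
Proof. by move=> [C hC] gh; exists C => j Jj; rewrite (le_trans (gh j Jj))// hC. Qed.

Lemma quadratic_growth_cst a : quadratic_growth (fun=> a).
Proof.
exists `|a| => j _; rewrite -[leLHS]mulr1 ler_wpM2l//.
by rewrite -natrX ler1n expn_gt0.
Qed.

Lemma basis_mean_lin a b g h : quadratic_growth g -> quadratic_growth h ->
  basis_mean (fun j => a * g j + b * h j) = a * basis_mean g + b * basis_mean h.
Proof.
move=> /quadratic_growth_cvg cg /quadratic_growth_cvg ch.
rewrite /basis_mean; apply: cvg_lim => //.
have -> : (fun j => (a * g j + b * h j) * p j) =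
    a *: (fun j => g j * p j) + b *: (fun j => h j * p j).
  by apply/funext => j; rewrite !fctE /GRing.scale /=; ring.
rewrite seriesD !seriesZ; apply: cvgD; apply: cvgZl_tmp; [exact: cg|exact: ch].
Qed.

Lemma eq_basis_mean g h : (forall j, J j -> g j = h j) -> basis_mean g = basis_mean h.
Proof.
move=> gh; rewrite /basis_mean; congr (limn (series _)); apply/funext => j.
by case: (boolP (J j)) => [/gh ->//|/basis_off_J ->]; rewrite !mulr0.
Qed.

Lemma basis_mean_cst a : basis_mean (fun=> a) = a.
Proof.
rewrite /basis_mean (_ : (fun _ => _) = a *: p) ?seriesZ//.
apply: cvg_lim => //; rewrite -[X in _ --> X]mulr1; apply: cvgZl_tmp.
exact: cvg_series_pbasis admissible_nDkc Ix.
Qed.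

Lemma basis_mean_natr : basis_mean (fun j => j%:R) = (n + k%:R * c) * x.
Proof.
by apply: cvg_lim => //; exact: cvg_series_natr_pbasis admissible_nDkc Ix.
Qed.

Lemma quadratic_growth_natr : quadratic_growth (fun j => j%:R).
Proof.
exists 1 => j _; rewrite ger0_norm// mul1r -natrX ler_nat.
by rewrite (leq_trans (leqnSn j))// -[leqLHS]expn1 leq_pexp2l.
Qed.

Lemma ler_norm_basis_mean g h : quadratic_growth g -> quadratic_growth h ->
  (forall j, J j -> `|g j| <= h j) -> `|basis_mean g| <= basis_mean h.
Proof.
move=> /quadratic_growth_cvg cg /quadratic_growth_cvg ch gh.
have ghp j : `|g j * p j| <= h j * p j.
  case: (boolP (J j)) => [Jj|/basis_off_J ->]; last by rewrite !mulr0 normr0.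
  by rewrite normrM (ger0_norm (basis_ge0 j)) ler_wpM2r ?basis_ge0 ?gh.
rewrite -lim_norm// ler_lim//; first exact: is_cvg_norm.
by apply: nearW => N; rewrite (le_trans (ler_norm_sum _ _ _))// ler_sum.
Qed.

End Series.

(** * Taylor's bound on [Ic c] and the three estimates *)

Lemma Ic_segment (R : realType) (c x y z : R) :
  Ic c x -> Ic c y -> x <= z <= y -> Ic c z.
Proof.
move=> /Ic_ge0 x0 Iy /andP[xz zy].
by apply: (Ic_le Iy); rewrite zy (le_trans x0).
Qed.

Lemma C2_taylor (R : realType) (c : R) (f : R -> R) (a t : R) :
  C2 (Ic c) f -> bounded_in (Ic c) (derive2_in (Ic c) f) -> Ic c a -> Ic c t ->
  `|f t - (f a - derive_in (Ic c) f a * a + derive_in (Ic c) f a * t)| <=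
  supnorm (Ic c) (derive2_in (Ic c) f) / 2 * (t - a) ^+ 2.
Proof.
move=> [df dg _] bf Ia It.
rewrite (_ : _ - _ + _ = f a + derive_in (Ic c) f a * (t - a)); last by ring.
apply: taylor_in => //; first exact: Ic_segment.
by move=> y Iy; apply: (ub_le_sup bf); exists y.
Qed.

Lemma measurable_C2 (R : realType) (c : R) (f : R -> R) :
  C2 (Ic c) f -> measurable_fun (Ic c) f.
Proof.
move=> [df _ _]; apply: subspace_continuous_measurable_fun; first exact: measurable_Ic.
exact: derivable_in_continuous.
Qed.

Lemma Ic_ratio (R : realType) (c b d : R) :
  0 <= b -> 0 < d -> 0 <= d + c * b -> Ic c (b / d).
Proof.
move=> b0 d0 h; apply/IcP; split; first by rewrite divr_ge0// ltW.
have -> : 1 + c * (b / d) = (d + c * b) / d by field; rewrite gt_eqF.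
by rewrite divr_ge0// ltW.
Qed.

Theorem theorem1 (R : realType) (c n : R) (k rho : nat) (f : R -> R)
  (hn_nneg : 0 <= c -> c < n)
  (hn_neg : c < 0 -> exists N : nat, (0 < N)%N /\ - n / c = N%:R)
  (hk : (0 < k)%N) (hrho : (0 < rho)%N)
  (hk_neg : c < 0 -> k%:R < - n / c)
  (hnrho : (k%:R + 1) * c < n * rho%:R)
  (hf : C2 (Ic c) f)
  (hf2 : bounded_in (Ic c) (derive2_in (Ic c) f)) :
  forall (j : nat) (x : R), inJ c n k j -> Ic c x ->
  [/\ `| Afun c n k rho j f
         - f (((2 * j%:R + k%:R) * rho%:R + k%:R)
              / (2 * (n * rho%:R - k%:R * c))) |
      <= 1 / 2 * supnorm (Ic c) (derive2_in (Ic c) f) * VarA c n k rho j,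
      `| Vop c n k rho f x - Dop c n k rho f x |
      <= 1 / 2 * Eop c n k rho x * supnorm (Ic c) (derive2_in (Ic c) f) &
      `| Vop c n k rho f x
         - f ((2 * (n + k%:R * c) * rho%:R * x + k%:R * (rho%:R + 1))
              / (2 * (n * rho%:R - k%:R * c))) |
      <= 1 / 2 * supnorm (Ic c) (derive2_in (Ic c) f) * VarV c n k rho x].
Proof.
move=> j x jJ Ix; set K := supnorm _ _; set g := derive_in (Ic c) f.
have mf := measurable_C2 hf.
have d0 := subr_kc_gt0 hn_neg hk hk_neg hnrho.
have bE := bptE hn_neg hk hrho hk_neg hnrho.
have taylor a t : Ic c a -> Ic c t ->
  `|f t - (f a - g a * a + g a * t)| <= K / 2 * (t - a) ^+ 2 := C2_taylor hf hf2.
have Abound a i : Ic c a -> inJ c n k i ->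
  `|Afun c n k rho i f - (f a - g a * a + g a * bpt c n k rho i)| <=
  K / 2 * (Afun c n k rho i (@emon R 2) - 2 * a * bpt c n k rho i + a ^+ 2).
  move=> Ia iJ; apply: (Afun_bound hn_neg hk hrho hk_neg hnrho) => // t.
  exact: taylor.
have d2 : 0 < 2 * (n * rho%:R - k%:R * c) by rewrite mulr_gt0.
(* The nodes must lie in [Ic c] to serve as expansion points; for [c < 0] this is where [i + k <= N]
   enters. *)
have Ib i : inJ c n k i -> Ic c (bpt c n k rho i).
  have num0 : 0 <= (2 * i%:R + k%:R) * rho%:R + k%:R :> R.
    by rewrite addr_ge0// mulr_ge0// addr_ge0// mulr_ge0.
  move=> iJ; rewrite bE//; apply: Ic_ratio => //; case: (leP 0 c) => c0.
    by rewrite addr_ge0 ?(ltW d2)// mulr_ge0.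
  have [N nN kN] := neg_nE hn_neg hk_neg c0; move: iJ; rewrite (inJ_neg _ _ c0 nN) => iN.
  rewrite nN; have -> : 2 * (- c * N%:R * rho%:R - k%:R * c) +
      c * ((2 * i%:R + k%:R) * rho%:R + k%:R) =
      - c * ((2 * (N%:R - i%:R - k%:R) + k%:R) * rho%:R + k%:R) by ring.
  rewrite mulr_ge0 ?oppr_ge0 ?(ltW c0)// addr_ge0// mulr_ge0// addr_ge0// mulr_ge0//.
  by rewrite -addrA -opprD -natrD subr_ge0 ler_nat.
have Abpt i : inJ c n k i ->
    `|Afun c n k rho i f - f (bpt c n k rho i)| <= K / 2 * VarA c n k rho i.
  move=> iJ; have := Abound _ i (Ib i iJ) iJ; rewrite subrK => /le_trans; apply.
  by rewrite le_eqVlt /VarA -/(bpt c n k rho i); apply/orP; left; apply/eqP; ring.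
have am := admissible_nDkc hn_nneg hn_neg hk_neg.
have lin := @quadratic_growth_lin R c n k.
have growth_e2 : quadratic_growth c n k (fun i => Afun c n k rho i (@emon R 2)).
  eexists => i iJ; have /andP[h0 h1] := Afun_emon2_le hn_neg hk hrho hk_neg hnrho iJ.
  by rewrite ger0_norm//; exact: h1.
have Var_ge0 i : inJ c n k i -> 0 <= VarA c n k rho i.
  move=> iJ; set b := bpt c n k rho i.
  (* With the zero function, the zero affine part and [K = 1], the bound says that [(t - b) ^+ 2]
     has a nonnegative mean. *)
  have := @Afun_bound R c n k rho hn_neg hk hrho hk_neg hnrho i (cst 0) 0 0 1 b iJ.
  move=> /(_ (measurable_cst _)) h; have := le_trans (normr_ge0 _) (h _).
  have -> : VarA c n k rho i = 1 * (Afun c n k rho i (@emon R 2) -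
      2 * b * Afun c n k rho i (@emon R 1) + b ^+ 2).
    by rewrite /VarA /b /bpt; ring.
  by apply => t _; rewrite /= mul0r addr0 subrr normr0 mul1r sqr_ge0.
set D := n * rho%:R - k%:R * c in d0 d2 bE *.
pose al := rho%:R / D; pose be := (k%:R * (rho%:R + 1)) / (2 * D).
have bE' i : inJ c n k i -> bpt c n k rho i = al * i%:R + be * 1.
  by move=> iJ; rewrite bE// /al /be; field; rewrite gt_eqF.
have growth_b : quadratic_growth c n k (bpt c n k rho).
  have h := lin al be _ _ (quadratic_growth_natr c n k) (quadratic_growth_cst c n k 1).
  by apply: (quadratic_growth_le h) => i iJ; rewrite bE'.
have growth_c a := quadratic_growth_cst c n k a.
have K0 : 0 <= K.
  by apply: le_trans (normr_ge0 (derive2_in (Ic c) f x)) (ub_le_sup hf2 _); exists x.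
(* [L a i] is the functional applied to [K / 2 * (t - a) ^+ 2], and [T a i] below is the functional
   applied to the Taylor polynomial at [a]. The factors 1 fit the two-term linearity lemmas. *)
pose L a i := K / 2 * Afun c n k rho i (@emon R 2) +
   1 * (- (K * a) * bpt c n k rho i + (K / 2 * a ^+ 2) * 1).
have growth_L a : quadratic_growth c n k (L a) by apply: (lin) => //; apply: (lin).
pose T a i := (f a - g a * a) * 1 + g a * bpt c n k rho i.
have growth_T a : quadratic_growth c n k (T a) by apply: lin.
have Abound' a i : Ic c a -> inJ c n k i -> `|Afun c n k rho i f - T a i| <= L a i.
  move=> Ia iJ; have := Abound a i Ia iJ; rewrite /T mulr1 => /le_trans; apply.
  by rewrite le_eqVlt /L; apply/orP; left; apply/eqP; field.
(* Needed only for the summability of [Dop]: [L x i] exceeds [K / 2 * (bpt c n k rho i - x) ^+ 2] by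
   [K / 2] times the variance. *)
have fbound i : inJ c n k i -> `|f (bpt c n k rho i) - T x i| <= L x i.
  move=> iJ; have := taylor x _ Ix (Ib i iJ); rewrite /T mulr1 => /le_trans; apply.
  have := mulr_ge0 K0 (Var_ge0 i iJ); rewrite /VarA -/(bpt c n k rho i) /L.
  by move=> h; lra.
have growth_near (h : nat -> R) : (forall i, inJ c n k i -> `|h i - T x i| <= L x i) ->
    quadratic_growth c n k h.
  move=> hh; have gd : quadratic_growth c n k (fun i => h i - T x i).
    apply: (quadratic_growth_le (growth_L x)) => i iJ.
    by rewrite (le_trans (hh i iJ))// ler_norm.
  apply: (quadratic_growth_le (lin 1 1 _ _ gd (growth_T x))) => i iJ.
  by rewrite !mul1r subrK.
have growth_A : quadratic_growth c n k (fun i => Afun c n k rho i f).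
  by apply: growth_near => i iJ; exact: Abound'.
have growth_f : quadratic_growth c n k (fun i => f (bpt c n k rho i)).
  exact: growth_near.
have meanE h := sum_J_basis hn_neg hk_neg x h.
have mlin a b h1 h2 := @basis_mean_lin R c n k hn_nneg hn_neg hk_neg x Ix a b h1 h2.
have mnorm h1 h2 := @ler_norm_basis_mean R c n k hn_nneg hn_neg hk_neg x Ix h1 h2.
have mcst a := basis_mean_cst hn_nneg hn_neg hk_neg Ix a.
set B := (2 * (n + k%:R * c) * rho%:R * x + k%:R * (rho%:R + 1)) / (2 * D).
have VE1 : basis_mean c n k x (bpt c n k rho) = B.
  rewrite (eq_basis_mean hn_neg hk_neg x bE') mlin ?mcst//; last exact: quadratic_growth_natr.
  rewrite (basis_mean_natr hn_nneg hn_neg hk_neg Ix) /al /be /B.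
  by field; rewrite gt_eqF.
(* [B] is the value of [Vop] on [emon 1] at [x] and the expansion point for the third estimate. *)
have IB : Ic c B.
  have nk := admissible_ge0 am; have x0 := Ic_ge0 Ix.
  apply: Ic_ratio => //; first by rewrite addr_ge0// !mulr_ge0// addr_ge0.
  case: (leP 0 c) => c0.
    by rewrite addr_ge0 ?(ltW d2)// mulr_ge0// addr_ge0// !mulr_ge0// addr_ge0.
  have [N nN kN] := neg_nE hn_neg hk_neg c0; rewrite /D nN.
  have -> : 2 * (- c * N%:R * rho%:R - k%:R * c) +
      c * (2 * (- c * N%:R + k%:R * c) * rho%:R * x + k%:R * (rho%:R + 1)) =
      - c * (2 * (N%:R - k%:R) * rho%:R * (1 + c * x) + k%:R * rho%:R + k%:R) by ring.
  rewrite mulr_ge0 ?oppr_ge0 ?(ltW c0)// !addr_ge0// ?mulr_ge0// ?(Ic_1Dcx Ix)//.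
  by rewrite subr_ge0 ler_nat ltnW.
split.
- by rewrite -bE// (le_trans (Abpt j jJ))// le_eqVlt; apply/orP; left; apply/eqP; field.
- rewrite /Vop /Dop /Eop !meanE.
  have growth_V : quadratic_growth c n k (VarA c n k rho).
    apply: (quadratic_growth_le growth_e2) => i iJ; rewrite ger0_norm ?Var_ge0//.
    by rewrite (le_trans _ (ler_norm _))// /VarA gerBl sqr_ge0.
  have -> : 1 / 2 * basis_mean c n k x (VarA c n k rho) * K =
      basis_mean c n k x (fun i => K / 2 * VarA c n k rho i + 0 * 1).
    by rewrite mlin// mcst; field.
  have := mlin 1 (-1) _ _ growth_A growth_f; rewrite mul1r mulN1r => <-.
  apply: mnorm => [||i iJ]; [exact: lin|exact: lin|].
  by rewrite mul1r mulN1r mul0r addr0 Abpt.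
rewrite /VarV /Vop !meanE.
have -> : basis_mean c n k x (fun i => Afun c n k rho i (@emon R 1)) = B := VE1.
(* The mean of the Taylor polynomial at [B] is its value at the mean [B], so the first-order terms
   cancel. *)
have -> : f B = basis_mean c n k x (T B).
  by rewrite mlin// mcst VE1; ring.
have -> : 1 / 2 * K * (basis_mean c n k x (fun i => Afun c n k rho i (@emon R 2)) - B ^+ 2)
    = basis_mean c n k x (L B).
  by rewrite mlin//; [rewrite mlin// mcst VE1; field|exact: lin].
have := mlin 1 (-1) _ _ growth_A (growth_T B); rewrite mul1r mulN1r => <-.
apply: mnorm => [||i iJ]; [exact: lin|exact: growth_L|].
by rewrite mul1r mulN1r Abound'.
Qed.
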